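(* Let $K\subset\hat{\mathbb{C}}$ be a compact set and let $U$ be a component of $\hat{\mathbb{C}}\setminus K$. If $L\subset\partial U$ is a compactum, then every atom of $L$ lies in a single atom of $K$. Consequently, every atom of $L$ lies in a single atom of $\partial U$.
   Context: A compactum is a compact metrizable space; a continuum is a connected compactum (a single point is allowed). $\hat{\mathbb{C}}$ is the Riemann sphere. A Peano compactum is a compactum all of whose components are locally connected and such that for every constant $C>0$ at most finitely many of its components have diameter greater than $C$. An upper semi-continuous decomposition of a compactum $K$ into sub-continua is a partition of $K$ into continua whose associated equivalence relation is closed in $K\times K$. For every compactum $K\subset\hat{\mathbb{C}}$ there exists (known result) an upper semi-continuous decomposition $\mathcal{D}_K$ of $K$ into sub-continua whose quotient space is a Peano compactum and which refines every other upper semi-continuous decomposition of $K$ into sub-continua whose quotient space is a Peano compactum; it is called the core decomposition of $K$ with Peano quotient. The elements of $\mathcal{D}_K$ are called the atoms of $K$. *)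

(* Defs.v *)
From mathcomp Require Export all_boot all_order all_algebra generic_quotient.
From mathcomp Require Export all_classical all_reals all_analysis complex.
Export numFieldNormedType.Exports.

Set Implicit Arguments.
Unset Strict Implicit.
Unset Printing Implicit Defensive.

Import Order.TTheory GRing.Theory Num.Theory.

Local Open Scope classical_set_scope.
Local Open Scope ring_scope.
Local Open Scope quotient_scope.

(* The point at infinity is [None]. *)
Definition riemann_sphere (R : realType) : topologicalType :=
  one_point_compactification (R[i] : numClosedFieldType).

Definition boundary (T : topologicalType) (A : set T) : set T :=
  closure A `\` A^°.

Definition components (T : topologicalType) (A : set T) : set (set T) :=
  connected_component A @` A.

Definition locally_connected (X : topologicalType) : Prop :=
  forall (x : X) (U : set X), nbhs x U ->
    exists V : set X, [/\ open V, V x, V `<=` U & connected V].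

Definition compatible_metric (R : realType) (X : topologicalType)
    (d : X -> X -> R) : Prop :=
  [/\ forall x, d x x = 0,
      forall x y, d x y = 0 -> x = y,
      forall x y, d x y = d y x,
      forall y x z, d x z <= d x y + d y z
    & forall (x : X) (U : set X),
        nbhs x U <-> exists2 r, 0 < r & [set y | d x y < r] `<=` U].

Definition diameter (R : realType) (X : Type) (d : X -> X -> R) (A : set X) :
    \bar R :=
  ereal_sup [set (d p.1 p.2)%:E | p in A `*` A].

(* Two metrics inducing the same compact topology are uniformly equivalent, so
   the finiteness condition does not depend on the choice of [d]. *)
Definition peano_compactum (R : realType) (X : topologicalType) : Prop :=
  [/\ compact [set: X],
      forall A, components [set: X] A -> locally_connected (set_type A)
    & exists2 d : X -> X -> R, compatible_metric d &
        forall c : R, 0 < c ->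
          finite_set [set A | components [set: X] A /\
                              (c%:E < diameter d A)%E]].

(* When [D] is a partition, this says that [x] and [y] lie in the same element
   of [D]; in this form it is an equivalence relation for every [D]. *)
Definition same_element (X : topologicalType) (D : set (set X)) : rel X :=
  fun x y => `[< forall A, D A -> (A x <-> A y) >].

Lemma same_element_refl X D : reflexive (@same_element X D).
Proof. by move=> x; apply/asboolP. Qed.

Lemma same_element_sym X D : symmetric (@same_element X D).
Proof. by move=> x y; apply/asboolP/asboolP => h A DA; split=> /(h A DA). Qed.

Lemma same_element_trans X D : transitive (@same_element X D).
Proof.
move=> y x z /asboolP xy /asboolP yz; apply/asboolP => A DA.
exact: iff_trans (xy A DA) (yz A DA).
Qed.

Definition decomposition_equiv (X : topologicalType) (D : set (set X)) :
    equiv_rel X :=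
  EquivRel (same_element D) (@same_element_refl X D) (@same_element_sym X D)
    (@same_element_trans X D).

Definition decomposition_quotient (X : topologicalType) (D : set (set X)) :
    topologicalType :=
  quotient_topology {eq_quot (decomposition_equiv D)}.

(* In every use [X] is a compact subspace of the sphere, so metrizability of the
   elements of [D] is inherited; nonemptiness is part of [partition]. *)
Definition usc_decomposition (X : topologicalType) (D : set (set X)) : Prop :=
  [/\ partition D id [set: X],
      forall A, D A -> compact A /\ connected A
    & closed [set p : X * X | decomposition_equiv D p.1 p.2]].

Definition refines (X : Type) (D D' : set (set X)) : Prop :=
  forall A, D A -> exists2 B, D' B & A `<=` B.

Definition core_decomposition (R : realType) (X : topologicalType)
    (D : set (set X)) : Prop :=
  [/\ usc_decomposition D,
      peano_compactum R (decomposition_quotient D)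
    & forall D' : set (set X), usc_decomposition D' ->
        peano_compactum R (decomposition_quotient D') -> refines D D'].

(* Main.v *)
Require Import Defs.
From mathcomp Require Import ring lra.

(** Let [DK] be the core decomposition of [K], [Q] its quotient, and [g] the map
    from [L] to [Q].  The components of the fibres of [g] form a decomposition
    of [L], finer than the trace of [DK].  If this decomposition is upper
    semi-continuous with a Peano quotient [Y], then the core decomposition of
    [L] refines it, so every atom of [L] is contained in an element of [DK].

    Upper semi-continuity is general topology of compact Hausdorff spaces: a
    component of a fibre is an intersection of clopen pieces of that fibre
    ([component_relclopen]), which gives [fiber_components_usc].  The quotient
    [Y] is metrizable by Urysohn's construction ([compact_metrizable]), and a
    compact metric space is a Peano compactum as soon as, for every closed set,
    only finitely many of its components have diameter at least [c]
    ([peano_criterion]).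

    Suppose that infinitely many large components exist in a closed subset of
    [Y].  Their preimages are disjoint continua [N i] in [L].  Along an
    ultrafilter they accumulate on two points of [L] in different components of
    fibres, and even, because components of a fibre can be separated, on two
    points [x] and [y] with [g x <> g y] ([fiber_components_finite]).  Since [Q]
    is a Peano compactum, [g x] and [g y] have disjoint connected neighbourhoods
    in one component of [Q] which infinitely many of the sets [g @` N i] meet.
    The preimages in [K] of these neighbourhoods are disjoint continua [P] and
    [S], and three of the [N i] join them ([parallel_continua]).

    This is where the domain [U] enters.  It is connected, disjoint from [K],
    and accumulates on every point of the three continua.  So [P], [S] and [U]
    are each joined to three disjoint continua, which would draw the graph K33
    on the sphere ([three_crossings]).  After removing a point of [U] and
    inverting, the drawing lies in the plane, where it is impossible ([no_K33]).
    The proof of the latter is the van Kampen obstruction, in a discrete form: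
    for two edges without common vertex, the differences of their points never
    vanish, so the vector from one to the other turns by a total angle zero
    around the boundary of the product of the two edges; the sum of these
    relations over all such pairs of edges is a contradiction modulo 2.

    For the second claim, [boundary U] is itself a compact set disjoint from the
    open connected set [U], so it can play the role of [K] ([atoms_refine]). *)

Set Implicit Arguments.
Unset Strict Implicit.
Unset Printing Implicit Defensive.

Import Order.TTheory GRing.Theory Num.Theory.

Local Open Scope classical_set_scope.
Local Open Scope ring_scope.

(** * Parity of the turning of a chain of points *)

Section Turning.
Variable R : realType.
Implicit Types (z w v : R * R) (e : R).

(** The half-plane is completed by the positive real axis, so that exactly one of
    [z] and [- z] belongs to it when [z] is not zero. *)
Definition upper z : bool := (0 < z.2) || ((z.2 == 0) && (0 < z.1)).
(** For a step that is short compared to the distance to the origin, this tells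
    whether the step crosses the negative real axis, where the argument jumps. *)
Definition cut z w : bool := (upper z (+) upper w) && (z.1 < 0).
Definition near_by e z w : bool := (`|z.1 - w.1| < e) && (`|z.2 - w.2| < e).
Definition far e z : bool := (e <= `|z.1|) || (e <= `|z.2|).

Lemma upperN e z : 0 < e -> far e z -> upper (- z) = ~~ upper z.
Proof.
rewrite /far /upper /= => e0 fz; rewrite oppr_gt0 oppr_eq0 oppr_gt0.
case: ltgtP fz => //= ->; rewrite normr0 [e <= 0]leNgt e0 orbF => ez.
by case: ltgtP ez => // ->; rewrite normr0 leNgt e0.
Qed.

(** A short step that crosses the real axis starts and ends close to this axis.
    All points nearby are then far from the imaginary axis, on the same side. *)
Lemma left_const e z w v : 0 < e -> far (4 * e) z -> far (4 * e) w ->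
  far (4 * e) v -> near_by (2 * e) z w -> near_by (2 * e) z v ->
  upper z != upper w -> (v.1 < 0) = (z.1 < 0).
Proof.
rewrite /far /near_by => e0 fz fw fv /andP[zw1 zw2] /andP[zv1 zv2] u.
have [z2 w2] : `|z.2| < 2 * e /\ `|w.2| < 2 * e.
  move: u zw2; rewrite /upper.
  by case: (ltgtP z.2 0) (ltgtP w.2 0) => z20 [] w20 //=; rewrite !ltr_norml; lra.
have z1 : 4 * e <= `|z.1| by case/orP: fz => // z2'; lra.
have v1 : 4 * e <= `|v.1|.
  case/orP: fv => // v2'; move: zv2; rewrite ltr_norml => /andP[a b].
  by move: z2 v2'; rewrite ltr_norml ler_normr => /andP[] ? ? /orP[]; lra.
move: zv1 z1 v1; rewrite ltr_norml !ler_normr => /andP[a b].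
by case/orP=> ? /orP[] ?; apply/idP/idP; lra.
Qed.

Lemma near_byC e z w : near_by e z w = near_by e w z.
Proof. by rewrite /near_by distrC (distrC z.2). Qed.

Lemma near_byBl e v z w : near_by e (z - v) (w - v) = near_by e z w.
Proof.
have E (a b c : R) : a - c - (b - c) = a - b by ring.
by rewrite /near_by /= !E.
Qed.

Lemma near_byBr e v z w : near_by e (v - z) (v - w) = near_by e z w.
Proof.
have E (a b c : R) : a - c - (a - b) = b - c by ring.
by rewrite near_byC /near_by /= !E.
Qed.

Lemma near_by_le e e' z w : e <= e' -> near_by e z w -> near_by e' z w.
Proof. by move=> ee /andP[a b]; rewrite /near_by !(lt_le_trans _ ee). Qed.

Lemma near_byD e z z' w w' : near_by e z z' -> near_by e w w' ->
  near_by (2 * e) (z - w) (z' - w').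
Proof.
rewrite /near_by /= => /andP[a b] /andP[c d]; apply/andP.
by rewrite !ltr_norml in a b c d *; split; lra.
Qed.

(** A small quadrilateral far from the origin does not wind around it: the two
    ways from [z1] to [z3] cross the negative real axis with the same parity. *)
Lemma cut_quad e z1 z2 z3 z4 : 0 < e ->
  far (4 * e) z1 -> far (4 * e) z2 -> far (4 * e) z3 -> far (4 * e) z4 ->
  near_by (2 * e) z1 z2 -> near_by (2 * e) z1 z3 -> near_by (2 * e) z1 z4 ->
  near_by (2 * e) z2 z3 -> near_by (2 * e) z2 z4 -> near_by (2 * e) z3 z4 ->
  cut z1 z2 (+) cut z4 z3 = cut z1 z4 (+) cut z2 z3.
Proof.
move=> e0 f1 f2 f3 f4 n12 n13 n14 n23 n24 n34; rewrite /cut.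
have [E|] := boolP [&& upper z1 == upper z2, upper z1 == upper z3 &
                   upper z1 == upper z4].
  by case/and3P: E => /eqP <- /eqP <- /eqP <-; rewrite addbb.
have c12 := left_const e0 f1 f2 _ n12 _.
have c13 := left_const e0 f1 f3 _ n13 _.
have c14 := left_const e0 f1 f4 _ n14 _.
rewrite !negb_and => /or3P[] u.
- rewrite (c12 _ f2 n12 u) (c12 _ f4 n14 u).
  by case: (upper z1) (upper z2) (upper z3) (upper z4) (_ < _) => [] [] [] [] [].
- rewrite (c13 _ f2 n12 u) (c13 _ f4 n14 u).
  by case: (upper z1) (upper z2) (upper z3) (upper z4) (_ < _) => [] [] [] [] [].
- rewrite (c14 _ f2 n12 u) (c14 _ f4 n14 u).
  by case: (upper z1) (upper z2) (upper z3) (upper z4) (_ < _) => [] [] [] [] [].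
Qed.

(** Steps of [- z] across the negative real axis are steps of [z] across the
    positive one; a step crosses one of the two half-axes exactly when it changes
    half-plane. *)
Lemma cutN e z w : 0 < e -> far (4 * e) z -> far (4 * e) w ->
  near_by (2 * e) z w ->
  cut (- z) (- w) = cut z w (+) (upper z (+) upper w).
Proof.
move=> e0 fz fw n; have e4 : 0 < 4 * e by lra.
rewrite /cut !(upperN e4) // addNb addbN negbK.
have [->|u] := eqVneq (upper z) (upper w); first by rewrite addbb.
have : 4 * e <= `|z.1|.
  case/orP: (fz) => // z2; move: u (n); rewrite /upper /near_by.
  move=> u /andP[_]; move: u z2; rewrite ltr_norml ler_normr.
  by case: (ltgtP z.2 0) (ltgtP w.2 0) => ? [] ? //= _ /orP[]; lra.
rewrite ler_normr => zz; have -> : (z.1 < 0) = ~~ ((- z).1 < 0).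
  by rewrite -leNgt /=; apply/idP/idP; case/orP: zz; lra.
by case: (_ < _); case: (_ (+) _).
Qed.

(** The winding number modulo 2 around [v] of the chain [x :: s] when it is
    closed.  For other chains this parity depends on the choice of the cut, the
    same for all chains. *)
Fixpoint turn v x (s : seq (R * R)) : bool :=
  if s is y :: s' then cut (x - v) (y - v) (+) turn v y s' else false.

(** The sum of the relations [cut_quad] along the chain, the other two sides of
    each quadrilateral being the displacement from [v] to [v']. *)
Lemma turn_step e v v' x s : 0 < e -> near_by e v v' -> path (near_by e) x s ->
  {in x :: s, forall y, far (4 * e) (y - v) && far (4 * e) (y - v')} ->
  turn v x s (+) turn v' x s =
  cut (x - v) (x - v') (+) cut (last x s - v) (last x s - v').
Proof.
move=> e0 vv; elim: s x => [|y s IH] x /=; first by rewrite addbb.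
case/andP=> xy p f; have le2 : e <= 2 * e by lra.
have /andP[fx fx'] := f x (mem_head _ _).
have /andP[fy fy'] : far (4 * e) (y - v) && far (4 * e) (y - v').
  by apply: f; rewrite !inE eqxx orbT.
rewrite addbACA IH //; last by move=> z zs; apply: f; rewrite inE zs orbT.
have Q := @cut_quad e (x - v) (y - v) (y - v') (x - v') e0 fx fy fy' fx'.
rewrite Q.
- by rewrite -!addbA addKb.
- by rewrite near_byBl (near_by_le le2).
- exact: near_byD.
- by rewrite near_byBr (near_by_le le2).
- by rewrite near_byBr (near_by_le le2).
- by rewrite near_byC; apply: near_byD => //; rewrite near_byC.
- by rewrite near_byBl near_byC (near_by_le le2).
Qed.

(** For two chains far apart, the vector from a point of one to a point of the
    other extends to the product of the two chains without vanishing, hence it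
    does not turn along the boundary of this product.  The right-hand side comes
    from [cutN], used to reverse the vector on two of the four sides. *)
Lemma turn_pair e x s y t : 0 < e ->
  path (near_by e) x s -> path (near_by e) y t ->
  {in x :: s & y :: t, forall z w, far (4 * e) (w - z)} ->
  turn y x s (+) turn (last y t) x s (+) (turn x y t (+) turn (last x s) y t) =
  (upper (y - x) (+) upper (last y t - x)) (+)
  (upper (y - last x s) (+) upper (last y t - last x s)).
Proof.
move=> e0 ps; elim: t y => [|z t IH] y; first by rewrite /= !addbb.
move=> /= /andP[yz pt] f; have le2 : e <= 2 * e by lra.
have e4 : 0 < 4 * e by lra.
have {}IH : turn z x s (+) turn (last z t) x s (+) (turn x z t (+)
    turn (last x s) z t) = upper (z - x) (+) upper (last z t - x) (+)
    (upper (z - last x s) (+) upper (last z t - last x s)).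
  by apply: IH => // a b ia ib; apply: f => //; rewrite inE ib orbT.
have zin : z \in y :: z :: t by rewrite !inE eqxx orbT.
have fN a b : far (4 * e) (a - b) -> far (4 * e) (b - a).
  by rewrite -opprB /far /= !normrN.
have S := @turn_step e y z x s e0 yz ps.
have {}S : turn y x s (+) turn z x s =
    cut (x - y) (x - z) (+) cut (last x s - y) (last x s - z).
  by apply: S => a ia; apply/andP; split; apply: fN; apply: f; rewrite ?mem_head.
have C a : a \in x :: s -> cut (a - y) (a - z) =
    cut (y - a) (z - a) (+) (upper (y - a) (+) upper (z - a)).
  move=> ia; rewrite -(opprB y) -(opprB z).
  apply: (cutN e0); rewrite ?f ?mem_head ?near_byBl //.
  exact: near_by_le yz.
have X a b c c1 c2 d g : a (+) c (+) ((c1 (+) d) (+) (c2 (+) g)) =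
    a (+) b (+) (b (+) c (+) (d (+) g)) (+) (c1 (+) c2).
  by case: a b c c1 c2 d g => [] [] [] [] [] [] [].
rewrite (X _ (turn z x s)) S IH (C x) ?mem_head // (C (last x s)) ?mem_last //.
move: (cut _ _) (cut _ _) (upper (y - x)) (upper (z - x)) (upper (y - last x s)).
move: (upper _) (upper _) (upper _).
by do 8![case].
Qed.
End Turning.

(** * The graph K33 is not planar *)

(** The sum of the relations [turn_pair] for two pairs of edges that exchange
    the endpoints [i] and [j]; [m] and its negation stem from the vectors
    joining these two vertices, which are opposite. *)
Lemma addb_cancel_pair (A0 A1 B01 B10 C0 C1 D01 D10 a b0 b1 c0 c1 m : bool) :
  A0 (+) B01 (+) (C1 (+) D10) = a (+) b1 (+) (c0 (+) m) ->
  A1 (+) B10 (+) (C0 (+) D01) = a (+) b0 (+) (c1 (+) ~~ m) ->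
  (B01 (+) B10) (+) (D01 (+) D10) =
  ~~ ((A0 (+) C0 (+) (b0 (+) c0)) (+) (A1 (+) C1 (+) (b1 (+) c1))).
Proof.
have -> : (B01 (+) B10) (+) (D01 (+) D10) =
    (A0 (+) B01 (+) (C1 (+) D10)) (+) (A1 (+) B10 (+) (C0 (+) D01)) (+)
    ((A0 (+) C0) (+) (A1 (+) C1)).
  by case: A0 A1 B01 B10 C0 C1 D01 D10 => [] [] [] [] [] [] [] [].
move=> -> ->; move: (A0 (+) C0) (A1 (+) C1) => x y.
by case: a b0 b1 c0 c1 m x y => [] [] [] [] [] [] [] [].
Qed.

Section Kuratowski.
Variable R : realType.
Implicit Types (p n : 'I_3 -> R * R).

(** Let [T k] be the number of turns of the edges at the vertex [p k] around the
    other vertices [n j], modulo 2.  In the sum of the relations [turn_pair] over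
    the six pairs formed by an edge at [p k] and an edge at [p l], the turns
    around [p k] and [p l] occur twice, and there remains [T k (+) T l = 1],
    since three pairs of opposite vectors [n j - n i] contribute.  Three booleans
    cannot be pairwise distinct. *)
Lemma no_K33_chains (e : R) p n (s : 'I_3 -> 'I_3 -> seq (R * R)) : 0 < e ->
  (forall k i, path (near_by e) (p k) (s k i)) ->
  (forall k i, last (p k) (s k i) = n i) ->
  (forall k l i j, k != l -> i != j ->
     {in p k :: s k i & p l :: s l j, forall z w, far (4 * e) (w - z)}) ->
  False.
Proof.
move=> e0 ps ls fs.
pose t k i v := turn v (p k) (s k i).
have rel k l i j : k != l -> i != j ->
    t k i (p l) (+) t k i (n j) (+) (t l j (p k) (+) t l j (n i)) =
    upper (p l - p k) (+) upper (n j - p k) (+)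
    (upper (p l - n i) (+) upper (n j - n i)).
  move=> kl ij; have := turn_pair e0 (ps k i) (ps l j) (fs _ _ _ _ kl ij).
  by rewrite !ls.
(* Only these turns survive in the sum over (i, j) and (j, i). *)
pose S k i j := t k i (n j) (+) t k j (n i).
pose g k l i := t k i (p l) (+) t l i (p k) (+)
  (upper (n i - p k) (+) upper (p l - n i)).
have relS k l i j : k != l -> i != j ->
    S k i j (+) S l i j = ~~ (g k l i (+) g k l j).
  move=> kl ij; apply: (addb_cancel_pair (rel _ _ _ _ kl ij)).
  have ji : j != i by rewrite eq_sym.
  have f : far (4 * e) (n j - n i).
    by apply: (fs k l i j kl ij); [rewrite -(ls k i)|rewrite -(ls l j)];
      exact: mem_last.
  have e4 : 0 < 4 * e by lra.
  by rewrite (rel _ _ _ _ kl ji) -(opprB (n j) (n i)) (upperN e4 f).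
pose T k := S k 0 1 (+) S k 0 2 (+) S k 1 2.
have relT k l : k != l -> T k (+) T l = true.
  move=> kl; rewrite /T; move: (relS _ _ 0 1 kl isT) (relS _ _ 0 2 kl isT).
  move: (relS _ _ 1 2 kl isT).
  move: (S k 0 1) (S k 0 2) (S k 1 2) (S l 0 1) (S l 0 2) (S l 1 2).
  move: (g k l 0) (g k l 1) (g k l 2).
  by do 9![case].
move: (relT 0 1 isT) (relT 0 2 isT) (relT 1 2 isT).
by case: (T 0) (T 1) (T 2) => [] [] [].
Qed.

Lemma near_by_open (e : R) (z : R * R) : open [set w | near_by e z w].
Proof.
rewrite openE => w /andP[w1 w2]; exists (ball z.1 e, ball z.2 e); last first.
  by move=> v /= []; rewrite -!ball_normE /= /near_by => -> ->.
by split; apply: open_nbhs_nbhs; split; rewrite -?ball_normE //; exact: ball_open.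
Qed.

Lemma near_by_nbhs (z : R * R) (U : set (R * R)) : nbhs z U <->
  exists2 e, 0 < e & [set w | near_by e z w] `<=` U.
Proof.
split=> [[[A B] /= [/nbhs_ballP[a a0 aA] /nbhs_ballP[b b0 bB]] ABU]|[e e0 eU]].
  exists (Num.min a b); first by rewrite lt_min a0.
  move=> w; rewrite /= /near_by !lt_min => /andP[/andP[wa _] /andP[_ wb]].
  by apply: ABU; split; [exact: aA|exact: bB].
apply: filterS eU _; apply: open_nbhs_nbhs; split; first exact: near_by_open.
by rewrite /= /near_by !subrr normr0 e0.
Qed.

(** The set of points that can be reached is open and closed in [E]. *)
Lemma connected_chain (e : R) (E : set (R * R)) x y : 0 < e -> connected E ->
  E x -> E y -> exists s, [/\ path (near_by e) x s, last x s = y &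
    {in x :: s, forall z, E z}].
Proof.
move=> e0 cE Ex Ey.
pose B := [set y | E y /\ exists s, [/\ path (near_by e) x s, last x s = y &
    {in x :: s, forall z, E z}]].
pose box z := [set w : R * R | near_by e z w].
have obox z : open (box z) by exact: near_by_open.
have ext z w : B z -> E w -> near_by e z w -> B w.
  move=> [Ez [s [ps ls sE]]] Ew zw; split=> //; exists (rcons s w).
  split; first by rewrite rcons_path ps ls.
    by rewrite last_rcons.
  by move=> v; rewrite -rcons_cons mem_rcons inE => /orP[/eqP->//|/sE].
have selfbox z : box z z by rewrite /box/= /near_by !subrr normr0 e0.
suff BE : B = E by move: Ey; rewrite -{1}BE => -[].
apply: cE.
- exists x; split=> //; exists [::]; split=> // z.
  by rewrite inE => /eqP ->.
- exists (\bigcup_(z in B) box z); first by apply: bigcup_open.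
  apply/seteqP; split=> [z Bz|w [Ew [z Bz zw]]]; last exact: ext zw.
  by split; [case: Bz|exists z].
- exists (~` \bigcup_(z in E `\` B) box z).
    by apply/open_closedC/bigcup_open.
  apply/seteqP; split=> [z Bz|w [Ew nw]].
    split; first by case: Bz.
    move=> [w [Ew nBw] wz]; apply: nBw; apply: ext Ew _; first exact: Bz.
    by rewrite near_byC.
  by apply: contrapT => nB; apply: nw; exists w.
Qed.

Lemma compact_gap (A B : set (R * R)) : compact A -> compact B ->
  A `&` B = set0 -> \forall e \near (0 : R)^'+,
  forall x y, A x -> B y -> far e (y - x).
Proof.
move=> cA cB AB0.
have [[a0 Aa0]|A0] := pselect (A !=set0); last first.
  by near=> e => x y Ax; case: A0; exists x.
have [[b0 Bb0]|B0] := pselect (B !=set0); last first.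
  by near=> e => x y _ By; case: B0; exists y.
pose f (z : (R * R) * (R * R)) : R := `|z.2 - z.1|.
have cf : {within A `*` B, continuous f}.
  apply: continuous_subspaceT => z; apply: cvg_norm; apply: cvgB.
    exact: cvg_snd.
  exact: cvg_fst.
have [[a b] /=] := compact_EVT_min (ex_intro _ (a0, b0) (conj Aa0 Bb0))
  (compact_setX cA cB) cf.
rewrite inE => -[/= Aa Bb] min.
have f0 : 0 < f (a, b).
  rewrite normr_gt0 subr_eq0 /=; apply/eqP => ba.
  have : (A `&` B) a by split=> //; rewrite -ba.
  by rewrite AB0.
near=> e => x y Ax By.
have ef : e <= f (a, b) by near: e; exact: nbhs_right_le.
have := min (x, y); rewrite inE => /(_ (conj Ax By)) /(le_trans ef).
by rewrite /f prod_normE le_max.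
Unshelve. all: by end_near. Qed.

(** Disjoint compact edges are at a positive distance, and it suffices to replace
    each edge by a chain of points of the edge with steps that are short
    compared to all these distances: the edges need not be arcs, and edges with
    a common vertex may intersect. *)
Theorem no_K33 p n (E : 'I_3 -> 'I_3 -> set (R * R)) :
  (forall k i, compact (E k i)) -> (forall k i, connected (E k i)) ->
  (forall k i, E k i (p k)) -> (forall k i, E k i (n i)) ->
  (forall k l i j, k != l -> i != j -> E k i `&` E l j = set0) -> False.
Proof.
move=> cE nE Ep En EE.
have : \forall e \near (0 : R)^'+, forall k l i j, k != l -> i != j ->
    forall x y, E k i x -> E l j y -> far e (y - x).
  pose G (q : ('I_3 * 'I_3) * ('I_3 * 'I_3)) (e : R) := q.1.1 != q.1.2 ->
    q.2.1 != q.2.2 -> forall x y, E q.1.1 q.2.1 x -> E q.1.2 q.2.2 y ->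
    far e (y - x).
  have : \forall e \near (0 : R)^'+, forall q, G q e.
    apply: filter_forall => -[[k l] [i j]]; rewrite /G /=.
    have [->|kl] := eqVneq k l; first by apply: nearW => e /eqP.
    have [->|ij] := eqVneq i j; first by apply: nearW => e _ /eqP.
    by apply: filterS (compact_gap (cE k i) (cE l j) (EE _ _ _ _ kl ij)) => e h _ _.
  by apply: filterS => e h k l i j; exact: (h ((k, l), (i, j))).
move=> gap.
have [d [d0 gapd]] : exists d : R, 0 < d /\ forall k l i j, k != l -> i != j ->
    forall x y, E k i x -> E l j y -> far d (y - x).
  have gt0 : \forall e \near (0 : R)^'+, 0 < e by exact: nbhs_right_gt.
  near (0 : R)^'+ => d; exists d; split; near: d.
    exact: gt0.
  exact: gap.
have d4 : 0 < d / 4 by rewrite divr_gt0.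
have chain k i := cid (connected_chain d4 (nE k i) (Ep k i) (En k i)).
apply: (@no_K33_chains (d / 4) p n (fun k i => projT1 (chain k i))) => //.
- by move=> k i; case: (chain k i) => ? [].
- by move=> k i; case: (chain k i) => ? [].
- move=> k l i j kl ij z w; case: (chain k i) => s [_ _ sE] /=.
  case: (chain l j) => t [_ _ tE] /= /sE Ez /tE Ew.
  by rewrite mulrC divfK //; exact: (gapd k l i j).
Unshelve. all: by end_near. Qed.
End Kuratowski.

(** * Components in compact Hausdorff spaces *)

Section CompactHausdorff.
Variable T : topologicalType.
Hypothesis hT : hausdorff_space T.
Hypothesis cT : compact [set: T].
Implicit Types (A B C F N O P S : set T) (x y : T).

Lemma closed_compactT A : closed A -> compact A.
Proof. by move=> cA; exact: (subclosed_compact cA cT). Qed.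

Lemma separate_closed A B : closed A -> closed B -> A `&` B = set0 ->
  exists U V, [/\ open U, open V, A `<=` U, B `<=` V & U `&` V = set0].
Proof.
move=> cA cB AB0; have /(_ A cA) nT := compact_normal hT cT.
have /nT[U nU clU] : set_nbhs A (~` B).
  by apply/set_nbhsP; exists (~` B); split;
    [exact: closed_openC|exact/disjoints_subset|].
have /set_nbhsP[W [oW AW WU]] := nU.
exists W, (~` closure U); split=> //.
- exact/closed_openC/closed_closure.
- by apply: subsetCr => z /clU.
- by apply/disjoints_subset; rewrite setCK => z /WU /subset_closure.
Qed.

(** Otherwise the traces of the sets of [D] on the complement of [O] would
    generate a proper filter, with a cluster point in all sets of [D]. *)
Lemma directed_closed_sub (D : set (set T)) O : D !=set0 ->
  (forall A, D A -> closed A) ->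
  (forall A B, D A -> D B -> D (A `&` B)) ->
  open O -> \bigcap_(A in D) A `<=` O -> exists2 A, D A & A `<=` O.
Proof.
move=> D0 Dc DI oO DO; apply: contrapT => nA.
pose G := filter_from D (fun A => A `\` O).
have FG : Filter G.
  apply: filter_from_filter => // A B DA DB; exists (A `&` B); first exact: DI.
  by move=> z [[]].
have PG : ProperFilter G.
  apply: filter_from_proper => A DA; apply: contrapT => A0; apply: nA.
  by exists A => // z Az; apply: contrapT => nO; apply: A0; exists z.
have [|p [_ clp]] := cT PG; first exact: filterT.
have clP A : D A -> closure (A `\` O) p.
  by rewrite clusterE in clp => DA; apply: clp; exists A.
have /DO Op : (\bigcap_(A in D) A) p.
  move=> A DA; by apply: (Dc A DA p); apply: (closureS _ (clP A DA)) => z [].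
have [A DA] := D0; have [z [[_ nOz] /nOz//]] := clP A DA O (open_nbhs_nbhs (conj oO Op)).
Qed.

Lemma closed_separated A B : closed (A `|` B) -> separated A B ->
  closed A /\ closed B.
Proof.
move=> cAB [sA sB]; split.
- move=> z zA; have [//|Bz] : (A `|` B) z.
    by apply: (cAB z); apply: (closureS _ zA); exact: subsetUl.
  have : (closure A `&` B) z by [].
  by rewrite sA.
- move=> z zB; have [Az|//] : (A `|` B) z.
    by apply: (cAB z); apply: (closureS _ zB); exact: subsetUr.
  have : (A `&` closure B) z by [].
  by rewrite sB.
Qed.

Lemma disjoint_closed_separated A B : closed A -> closed B -> A `&` B = set0 ->
  separated A B.
Proof. by move=> /closure_id cA /closure_id cB AB; split; rewrite -?cA -?cB. Qed.

(** Components of compact Hausdorff spaces are quasi-components.  The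
    intersection [I] of the clopen parts of [F] containing [x] is connected: if
    two disjoint open sets cover it, then by compactness they cover one of these
    clopen parts, and they cut it into two clopen parts. *)
Lemma component_relclopen F x O : closed F -> F x -> open O ->
  connected_component F x `<=` O ->
  exists E, [/\ closed E, closed (F `\` E), E `<=` F, E x & E `<=` O].
Proof.
move=> cF Fx oO CO.
pose D := [set E | [/\ closed E, closed (F `\` E), E `<=` F & E x]].
suff [E [? ? ? ?] EO] : exists2 E, D E & E `<=` O by exists E.
have DF : D F by split=> //; rewrite setDv; exact: closed0.
have DI A B : D A -> D B -> D (A `&` B).
  move=> [cA cFA AF Ax] [cB cFB BF Bx]; split=> //.
  - exact: closedI.
  - by rewrite setDIr; exact: closedU.
  - by move=> z [/AF].
pose I := \bigcap_(E in D) E.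
have Dc A : D A -> closed A by case.
have cI : closed I by apply: closed_bigI => A /Dc.
apply: directed_closed_sub => //; first by exists F.
apply: subset_trans CO; apply: connected_component_max.
- by move=> E [].
- by move=> z /(_ F DF).
apply/connectedP => E [E0 IE sE].
have [cE0 cE1] : closed (E false) /\ closed (E true).
  by apply: closed_separated => //; rewrite -IE.
wlog E0x : E E0 IE sE cE0 cE1 / E false x.
  move=> W; have : (E false `|` E true) x by rewrite -IE => A [].
  case=> [|E1x]; first exact: W IE sE cE0 cE1.
  by apply: (W (E \o negb)) => //=; [rewrite setUC -IE|rewrite separatedC].
have [U [V [oU oV EU EV UV]]] :=
  separate_closed cE0 cE1 (separated_disjoint sE).
have [|||||A [cA cFA AF Ax] AUV] := @directed_closed_sub D (U `|` V) => //.
- by exists F.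
- exact: openU.
- by rewrite [X in X `<=` _]IE => z [/EU|/EV]; [left|right].
have [z Ez] := E0 true.
have : I z by rewrite [I]IE; right.
have dUV w : U w -> V w -> False.
  by move=> Uw Vw; have : (U `&` V) w by []; rewrite UV.
have DAU : D (A `\` V).
  split.
  - by rewrite setDE; apply: closedI => //; exact: open_closedC.
  - rewrite (_ : F `\` _ = (F `\` A) `|` (A `&` ~` U)).
      by apply: closedU => //; apply: closedI => //; exact: open_closedC.
    apply/seteqP; split=> [w [Fw nAV]|w [[Fw nA]|[Aw nU]]].
    + have [Aw|] := pselect (A w); last by left.
      by right; split=> // /dUV Vw; apply: nAV; split.
    + by split=> // -[].
    + by split; [exact: AF|case=> _; case: (AUV w Aw)].
  - by move=> w [/AF].
  - by split=> //; apply: dUV; exact: EU.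
by move=> /(_ _ DAU)[_]; apply; exact: EV.
Qed.

(** Boundary bumping.  The clopen part of [G] between the component and [O] is
    clopen in [N] too, because [G] contains the trace of [O] on [N]. *)
Lemma connected_sub_component_nbhs N G O x : connected N -> closed G -> G x ->
  G `<=` N -> open O -> connected_component G x `<=` O -> N `&` O `<=` G ->
  N `<=` O.
Proof.
move=> cN cG Gx GN oO CO NO.
have [E [cE cGE EG Ex EO]] := component_relclopen cG Gx oO CO.
suff EN : E = N by rewrite -EN.
apply: cN; first by exists x.
- exists (O `&` ~` (G `\` E)).
    by apply: openI => //; exact: closed_openC.
  apply/seteqP; split=> [z Ez|z [Nz [Oz nGE]]].
    by split; [exact/GN/EG|split; [exact: EO|case]].
  by apply: contrapT => nE; apply: nGE; split=> //; apply: NO.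
- by exists E => //; apply/esym/setIidPr => z /EG /GN.
Qed.

Lemma connected_between A B : connected A -> A `<=` B -> B `<=` closure A ->
  connected B.
Proof.
move=> cA AB BA U [y Uy] [V oV UV] [C cC UC].
have E : A `&` V = A.
  apply: cA.
  - move: Uy; rewrite UV => -[/BA Ay Vy].
    by have [w [Aw Vw]] := Ay V (open_nbhs_nbhs (conj oV Vy)); exists w.
  - by exists V.
  - exists C => //; have := UC; rewrite UV => /(congr1 (setI A)).
    by rewrite !setIA (setIidl AB).
have AC : A `<=` C.
  move=> z; rewrite -E => -[/AB Bz Vz].
  by have : (B `&` V) z by []; rewrite -UV UC => -[].
rewrite UC; apply/setIidPl => z /BA /(closureS AC).
by have /closure_id <- := cC.
Qed.
End CompactHausdorff.

(** * Upper semi-continuous decompositions *)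

Section Crossing.
Variable T : topologicalType.
Hypothesis hT : hausdorff_space T.
Hypothesis cT : compact [set: T].
Implicit Types (A B C D F N P S : set T) (x y : T).

(** Otherwise a neighbourhood of the closure of the component is disjoint from
    [S], and boundary bumping applies in this neighbourhood. *)
Lemma component_reaches N S x : closed N -> connected N -> closed S ->
  N x -> ~ S x -> N `&` S !=set0 ->
  closure (connected_component (N `\` S) x) `&` S !=set0.
Proof.
move=> cN nN cS Nx nSx [s [Ns Ss]]; apply: contrapT => clS0.
set C := connected_component _ _ in clS0.
have [U [V [oU oV CU SV UV]]] := separate_closed hT cT (@closed_closure _ C) cS
  (iffLR (nonemptyPn _) clS0).
have dUV z : U z -> V z -> False.
  by move=> Uz Vz; have : (U `&` V) z by []; rewrite UV.
have Cx : C x by apply: connected_component_refl.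
(* The closed set G of the boundary bumping is the part of N outside V. *)
have NU : N `<=` U.
  apply: (connected_sub_component_nbhs hT cT (G := N `&` ~` V) (x := x)) => //.
  - by apply: closedI => //; exact: open_closedC.
  - by split=> // Vx; apply: (dUV x) => //; exact/CU/subset_closure.
  - move=> z Gz; apply/CU/subset_closure; apply: connected_component_max Gz.
    + apply: connected_component_refl; split=> // Vx.
      by apply: (dUV x) => //; exact/CU/subset_closure.
    + move=> w /connected_component_sub[Nw nVw]; split=> // /SV.
      exact: nVw.
    + exact: component_connected.
  - by move=> z [Nz Uz]; split=> // /(dUV z Uz).
by apply: (dUV s); [exact: NU|exact: SV].
Qed.

(** A continuum from [P] to [S] may visit both sets many times.  The point [n]
    is chosen on a last passage: from [n] one reaches [P] without meeting [S] and
    [S] without meeting [P]. *)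
Lemma crossing_point N P S : closed N -> connected N -> closed P -> closed S ->
  P `&` S = set0 -> N `&` P !=set0 -> N `&` S !=set0 ->
  exists n C D, [/\ ~ P n /\ ~ S n,
    [/\ connected C, C `<=` N `\` S, C n & C `&` P !=set0] &
    [/\ connected D, D `<=` N `\` P, D n & D `&` S !=set0]].
Proof.
move=> cN nN cP cS PS0 [p [Np Pp]] NS.
have PS z : P z -> S z -> False.
  by move=> Pz Sz; have : (P `&` S) z by []; rewrite PS0.
have nSp : ~ S p by exact: PS.
set C := connected_component (N `\` S) p.
have Cp : C p by exact: connected_component_refl.
have [s [clCs Ss]] := component_reaches cN nN cS Np nSp NS.
rewrite -/C in clCs.
have CN : C `<=` N by move=> z /connected_component_sub[].
have clCN : closure C `<=` N by move=> z /(closureS CN); exact: cN.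
have clCC : closure C `\` S `<=` C.
  apply: connected_component_max.
  - by split=> //; exact: subset_closure.
  - by move=> z [/clCN].
  - apply: (@connected_between _ C); first exact: component_connected.
      move=> z Cz; split; first exact: subset_closure.
      by case/connected_component_sub: Cz.
    by move=> z [].
have nPs : ~ P s by move=> Ps; exact: PS Ps Ss.
(* Inside the closure of C, everything outside S belongs to C. *)
set D := connected_component (closure C `\` P) s.
have Ds : D s by exact: connected_component_refl.
have [q [clDq Pq]] : closure D `&` P !=set0.
  apply: component_reaches => //; first exact: closed_closure.
    by apply: connected_closure; exact: component_connected.
  by exists p; split=> //; exact: subset_closure.
have [n [Dn nSn]] : exists n, D n /\ ~ S n.
  apply: contrapT => nex; apply: (PS q) => //; apply: (cS).
  apply: (closureS _ clDq) => z Dz.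
  by apply: contrapT => nSz; apply: nex; exists z.
have [clCn nPn] : (closure C `\` P) n by exact: connected_component_sub Dn.
exists n, C, D; split=> //; split.
- exact: component_connected.
- exact: connected_component_sub.
- by apply: clCC; split.
- by exists p.
- exact: component_connected.
- by move=> z /connected_component_sub[/clCN].
- exact: Dn.
- by exists s.
Qed.
End Crossing.

Section ClosedMaps.
Variables (X Y : topologicalType) (q : X -> Y).

Lemma open_fiber_sub O : (forall C, closed C -> closed (q @` C)) -> open O ->
  open [set y | forall x, q x = y -> O x].
Proof.
move=> clq oO.
rewrite (_ : [set y | _] = ~` (q @` (~` O))).
  by apply/closed_openC/clq; exact: open_closedC.
apply/seteqP; split=> [y yO [x nOx /yO]//|y ny x xy].
by apply: contrapT => nOx; apply: ny; exists x.
Qed.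

Lemma compact_closed_map : compact [set: X] -> hausdorff_space Y ->
  continuous q -> forall C, closed C -> closed (q @` C).
Proof.
move=> cX hY cq C cC; apply: (compact_closed hY).
apply: continuous_compact; first exact: continuous_subspaceT.
exact: (subclosed_compact cC cX).
Qed.

(** A separation of the preimage is compatible with the fibres, as they are
    connected, so it induces a separation of [C] by two closed sets. *)
Lemma monotone_preimage_connected (C : set Y) :
  (forall C, closed C -> closed (q @` C)) -> continuous q ->
  (forall y, exists x, q x = y) ->
  (forall y, connected (q @^-1` [set y])) ->
  closed C -> connected C -> connected (q @^-1` C).
Proof.
move=> clq cq sq fq cC nC; apply/connectedP => E [E0 CE sE].
have [cE0 cE1] : closed (E false) /\ closed (E true).
  apply: closed_separated => //; rewrite -CE.
  by apply: preimage_closed => //; exact: closed_subspaceT.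
have dE : E false `&` E true = set0 by exact: separated_disjoint.
have fibE b y : (q @` E b) y -> C y -> q @^-1` [set y] `<=` E b.
  move=> [x Ex xy] Cy.
  have : q @^-1` [set y] `<=` E false `|` E true by rewrite -CE => z /= ->.
  move=> /(connected_subset sE)/(_ (fq y)) [] h; case: b Ex => Ex //.
    have : (E false `&` E true) x by split=> //; exact: h.
    by rewrite dE.
  have : (E false `&` E true) x by split=> //; exact: h.
  by rewrite dE.
have EC b x : E b x -> C (q x).
  by move=> Ex; have : (q @^-1` C) x by rewrite CE; case: b Ex; [right|left].
have CqE : C = q @` E false `|` q @` E true.
  apply/seteqP; split=> [y Cy|y]; last by case=> -[x Ex <-]; exact: (EC _ _ Ex).
  have [x xy] := sq y; have : (q @^-1` C) x by rewrite /= xy.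
  by rewrite CE => -[]; [left|right]; exists x.
move/connectedP: nC => /(_ (fun b => q @` E b)); apply; split.
- by move=> b; have [x Ex] := E0 b; exists (q x), x.
- exact: CqE.
- apply: disjoint_closed_separated; try exact: clq.
  rewrite -subset0 => y [y0 y1].
  have Cy : C y by rewrite CqE; left.
  have [x xy] := sq y.
  have : (E false `&` E true) x.
    by split; [exact: (fibE false y)|exact: (fibE true y)].
  by rewrite dE.
Qed.
End ClosedMaps.

Section UscQuotient.
Local Open Scope quotient_scope.
Variable X : topologicalType.
Hypothesis hX : hausdorff_space X.
Hypothesis cX : compact [set: X].
Variable D : set (set X).
Hypothesis uD : usc_decomposition D.

Local Notation Y := (decomposition_quotient D).
(** The projection with its codomain seen as a topological space. *)
Definition usc_pi : X -> Y := \pi_(quotient_topology {eq_quot (decomposition_equiv D)}).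
Local Notation q := usc_pi.

Lemma usc_pi_continuous : continuous q.
Proof. exact: pi_continuous. Qed.

Lemma usc_pi_surj y : exists x, q x = y.
Proof. by exists (repr y); rewrite /usc_pi reprK. Qed.

Lemma usc_piE x x' : q x = q x' <-> decomposition_equiv D x x'.
Proof.
have P := @eqmodP _ (decomposition_equiv D) x x'.
by split=> [h|/P]; [apply/P|].
Qed.

Lemma same_elementE x x' : same_element D x x' <-> exists A, [/\ D A, A x & A x'].
Proof.
have [[Dcov Dtriv _] _ _] := uD.
split=> [/asboolP h|[A [DA Ax Ax']]].
  have : cover D id x by rewrite Dcov.
  by move=> [A DA Ax]; exists A; split=> //; apply/(h A DA).
apply/asboolP => B DB; split=> Bx.
  by rewrite (Dtriv B A DB DA) //; exists x.
by rewrite (Dtriv B A DB DA) //; exists x'.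
Qed.

Lemma usc_fiber A x : D A -> A x -> q @^-1` [set q x] = A.
Proof.
move=> DA Ax; apply/seteqP; split=> [z /= /usc_piE /asboolP|z Az /=].
  by move=> /(_ A DA) ->.
by apply/usc_piE/same_elementE; exists A.
Qed.

Lemma usc_fiber_connected y : connected (q @^-1` [set y]).
Proof.
have [[Dcov _ _] Dc _] := uD; have [x <-] := usc_pi_surj y.
have : cover D id x by rewrite Dcov.
by move=> [A DA Ax]; rewrite (usc_fiber DA Ax); case: (Dc A DA).
Qed.

(** The saturation of [C] is the projection of the part of the closed
    equivalence relation above [C], a compact set. *)
Lemma usc_pi_closed C : closed C -> closed (q @` C).
Proof.
move=> cC; have [_ _ cR] := uD.
rewrite -openC.
suff : closed (q @^-1` (q @` C)) by rewrite -openC.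
rewrite (_ : _ @^-1` _ = snd @` ([set p : X * X | decomposition_equiv D p.1 p.2]
    `&` (C `*` [set: X]))).
  apply: (compact_closed hX); apply: continuous_compact.
    by apply: continuous_subspaceT => p; exact: cvg_snd.
  apply: (@subclosed_compact _ _ [set: X * X]) => //.
    apply: closedI => //.
    rewrite (_ : _ `*` _ = fst @^-1` C); last by apply/seteqP; split=> z // [].
    by apply: preimage_closed => // p _; exact: cvg_fst.
  by rewrite -setXTT; exact: compact_setX.
apply/seteqP; split=> [x /= [c Cc /usc_piE cx]|x [[c z] /= [cz [Cc _] <-]]].
  by exists (c, x).
by exists c => //; apply/usc_piE.
Qed.

Lemma usc_quotient_compact : compact [set: Y].
Proof.
have -> : [set: Y] = q @` [set: X].
  by apply/seteqP; split=> // y _; have [x xy] := usc_pi_surj y; exists x.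
apply: continuous_compact => //; apply: continuous_subspaceT.
exact: usc_pi_continuous.
Qed.

Lemma usc_quotient_hausdorff : hausdorff_space Y.
Proof.
rewrite open_hausdorff => y y' /eqP yy'.
have c1 z : closed (q @^-1` [set z]).
  have [x <-] := usc_pi_surj z.
  apply: preimage_closed; first by move=> ? _; exact: usc_pi_continuous.
  rewrite -image_set1; apply: usc_pi_closed.
  exact/accessible_closed_set1/hausdorff_accessible.
have [|U [V [oU oV yU yV UV]]] := separate_closed hX cX (c1 y) (c1 y').
  by rewrite -subset0 => x [/= xy xy']; apply: yy'; rewrite -xy -xy'.
exists ([set z | forall x, q x = z -> U x], [set z | forall x, q x = z -> V x]).
  by split; rewrite inE => x xz; [exact: yU|exact: yV].
split; [exact: (open_fiber_sub usc_pi_closed)|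
  exact: (open_fiber_sub usc_pi_closed)|].
apply/eqP; rewrite -subset0 => z [zU zV]; have [x xz] := usc_pi_surj z.
have : (U `&` V) x by split; [exact: zU|exact: zV].
by rewrite UV.
Qed.
End UscQuotient.

(** * Metrization *)

(** An enumeration is more convenient than a countable set of open sets; the
    indices that are not used get the empty set. *)
Lemma second_countable_seq (T : topologicalType) : @second_countable T ->
  exists b : nat -> set T, (forall n, open (b n)) /\
    forall x U, nbhs x U -> exists n, b n x /\ b n `<=` U.
Proof.
move=> [B /countable_injP[f finj] [Bo Bb]].
pose b n := xget set0 [set A | B A /\ f A = n].
have bE A : B A -> b (f A) = A.
  move=> BA; rewrite /b; case: xgetP => [C _ [BC fC]|/(_ A)[]//].
  by apply: finj; rewrite ?inE.
exists b; split=> [n|x U xU].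
  rewrite /b; case: xgetP => [A _ [BA _]|_]; [exact: Bo|exact: open0].
have [A [BA Ax] AU] := Bb x U xU.
by exists (f A); rewrite bE.
Qed.

(** By compactness, a neighbourhood of a fibre contains a finite union of basic
    open sets that covers the fibre.  The sets of points whose fibres are
    contained in such a finite union form a basis. *)
Lemma closed_map_second_countable (X Y : topologicalType) (q : X -> Y) :
  compact [set: X] -> hausdorff_space Y -> continuous q ->
  (forall y, exists x, q x = y) -> @second_countable X -> @second_countable Y.
Proof.
move=> cX hY cq sq /second_countable_seq[b [bo bb]].
pose O (s : seq nat) : set X := \bigcup_(i in [set` s]) b i.
have oO s : open (O s) by apply: bigcup_open => i _.
pose V s : set Y := [set y | forall x, q x = y -> O s x].
have clq := compact_closed_map cX hY cq.
exists (range V).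
  by apply: (sub_countable (card_image_le V setT)); exact: countableP.
split=> [_ [s _ <-]|y W]; first exact: open_fiber_sub.
rewrite nbhsE => -[W' [oW' W'y] W'W].
have cF : closed (q @^-1` [set y]).
  apply: preimage_closed => //.
  exact/accessible_closed_set1/hausdorff_accessible.
pose F := q @^-1` [set y].
pose good (s : seq nat) := forall i, i \in s -> b i `<=` q @^-1` W'.
have [|||||A [s [sW ->]] As] :=
    @directed_closed_sub X cX [set A | exists s, good s /\ A = F `\` O s] set0.
- by exists (F `\` O [::]), [::].
- by move=> _ [s [_ ->]]; rewrite setDE; apply: closedI => //; exact: open_closedC.
- move=> _ _ [s [gs ->]] [s' [gs' ->]]; exists (s ++ s'); split.
    by move=> i; rewrite mem_cat => /orP[/gs|/gs'].
  apply/seteqP; split=> x.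
    move=> [[Fx ns] [_ ns']]; split=> // -[i /=]; rewrite mem_cat => /orP[] ii bi.
      by apply: ns; exists i.
    by apply: ns'; exists i.
  move=> [Fx nss]; split; split=> // -[i /= ii bi]; apply: nss; exists i => //=;
    by rewrite mem_cat ii ?orbT.
- exact: open0.
- move=> x h; have xy : F x by have [|] := h (F `\` O [::]); first by exists [::].
  have [|n [bnx bnW]] := bb x (q @^-1` W').
    by apply: cq; rewrite xy; exact: open_nbhs_nbhs.
  have [|_] := h (F `\` O [:: n]).
    by exists [:: n]; split=> // i; rewrite inE => /eqP ->.
  by apply; exists n => //=; rewrite inE.
exists (V s).
  split; first by exists s.
  by move=> x xy; apply: contrapT => nO; apply: (As x).
move=> z Vz; apply: W'W; have [x xz] := sq z.
have [i is_ bi] := Vz x xz; rewrite -xz.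
exact: (sW i is_ x bi).
Qed.

Section Metrization.
Variables (R : realType) (Y : topologicalType).
Hypothesis hY : hausdorff_space Y.
Hypothesis cY : compact [set: Y].

(** The pairs of basic open sets [(i, j)] such that the closure of [b i] is
    contained in [b j] give countably many Urysohn functions [h n].  They separate
    points from closed sets, and the supremum of the distances between their
    values, with weights [2 ^- n], is a compatible metric. *)
Lemma compact_metrizable : @second_countable Y ->
  exists d : Y -> Y -> R, compatible_metric d.
Proof.
move=> /second_countable_seq[b [bo bb]].
(* A junk function when the two closed sets intersect, still with values in
   [0, 1]. *)
pose g i j : Y -> R := Urysohn (closure (b i)) (~` b j).
pose h n : Y -> R := if unpickle n is Some ij then g ij.1 ij.2 else fun=> 0.
have hE i j : h (pickle (i, j)) = g i j by rewrite /h pickleK.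
have ch n : continuous (h n).
  rewrite /h; case: unpickle => [ij|]; last exact: cst_continuous.
  exact: Urysohn_continuous.
have h01 n x : 0 <= h n x <= 1.
  rewrite /h; case: unpickle => [ij|]; last by rewrite lexx ler01.
  have := @Urysohn_range Y R (closure (b ij.1)) (~` b ij.2).
  by move=> /(_ (g ij.1 ij.2 x)); rewrite /= in_itv /=; apply; exists x.
have sepU x U : nbhs x U -> exists n, h n x = 0 /\ forall y, ~ U y -> h n y = 1.
  move=> /bb[j [bjx bjU]].
  have [|W xW clW] := compact_regular hY cY _ (open_nbhs_nbhs (conj (bo j) bjx)).
    exact: filterT.
  have [i [bix biW]] := bb x W xW.
  have clb : closure (b i) `<=` b j.
    by apply: subset_trans clW; exact: closureS.
  have us : uniform_separator (closure (b i)) (~` b j).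
    apply: (normal_uniform_separator (compact_normal hY cY)).
    - exact: closed_closure.
    - exact: open_closedC.
    - by apply/disjoints_subset; rewrite setCK.
  exists (pickle (i, j)); rewrite hE; split.
    apply: (Urysohn_sub0 us); exists x => //; exact: subset_closure.
  move=> y nUy; apply: (Urysohn_sub1 us); exists y => // bjy.
  exact/nUy/bjU.
pose t n x y : R := 2^-1 ^+ n * `|h n x - h n y|.
pose d x y : R := sup (range (fun n => t n x y)).
have h2 n : 0 < (2^-1 : R) ^+ n by rewrite exprn_gt0.
have t0 n x y : 0 <= t n x y by rewrite mulr_ge0 // ltW.
have tw n x y : t n x y <= 2^-1 ^+ n.
  rewrite /t ger_pMr // ler_norml.
  by have := h01 n x; have := h01 n y; lra.
have half_le1 : (2^-1 : R) <= 1 by lra.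
have h21 n : (2^-1 : R) ^+ n <= 1 by rewrite exprn_ile1 // invr_ge0.
have td n x y : t n x y <= d x y.
  apply: ub_le_sup; last by exists n.
  by exists 1 => _ [m _ <-]; apply: le_trans (tw _ _ _) (h21 m).
have dl x y c : (forall n, t n x y <= c) -> d x y <= c.
  by move=> tc; apply: ge_sup; [exists (t 0%N x y), 0%N|move=> _ [n _ <-]].
have d0 x y : 0 <= d x y by apply: le_trans (td 0%N x y).
have big x U : nbhs x U -> exists2 r, 0 < r & [set y | d x y < r] `<=` U.
  move=> /sepU[n [hx hy]]; exists (2^-1 ^+ n) => // y /= dr.
  apply: contrapT => /hy hy1; move: dr; rewrite ltNge => /negP; apply.
  by apply: le_trans (td n x y); rewrite /t hx hy1 sub0r normrN normr1 mulr1.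
exists d; split.
- move=> x; apply/eqP; rewrite eq_le d0 andbT; apply: dl => n.
  by rewrite /t subrr normr0 mulr0.
- move=> x y dxy; apply: contrapT => xy.
  have [|r r0] := big x (~` [set y]).
    apply: open_nbhs_nbhs; split; last by [].
    exact/closed_openC/accessible_closed_set1/hausdorff_accessible.
  by move=> /(_ y); rewrite /= dxy => /(_ r0).
- move=> x y; congr sup; apply: eq_imagel => n _.
  by rewrite /t distrC.
- move=> y x z; apply: dl => n.
  apply: le_trans (lerD (td n x y) (td n y z)).
  rewrite /t -mulrDr ler_pM2l //.
  by rewrite -(subrKA (h n y)) ler_normD.
- move=> x U; split; first exact: big.
  move=> [r r0 rU]; apply: filterS rU _.
  have r2 : 0 < r / 2 by rewrite divr_gt0.
  have [N hN] : exists N, (2^-1 : R) ^+ N < r / 2.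
    have : `|2^-1 : R| < 1 by rewrite ger0_norm //; lra.
    move=> /cvg_expr /cvgrPdist_lt /(_ (r / 2) r2)[N _ /(_ N (leqnn N))].
    by rewrite sub0r normrN ger0_norm ?(ltW (h2 _)) //; exists N.
  have : \forall y \near x, forall i : 'I_N, `|h i x - h i y| < r / 2.
    apply: filter_forall => i.
    by have /cvgrPdist_lt := ch i x; exact.
  apply: filterS => y hy /=.
  apply: le_lt_trans (_ : r / 2 < r); last by lra.
  apply: dl => n; have [nN|Nn] := ltnP n N.
    apply: le_trans (ltW (hy (Ordinal nN))).
    by rewrite /t ler_piMl.
  apply: le_trans (tw _ _ _) _; apply: le_trans (ltW hN).
  by rewrite ler_wiXn2l // invr_ge0.
Qed.
End Metrization.

(** * A criterion for Peano compacta *)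

Section SetVal.
Variables (T : topologicalType) (A : set T).

Lemma set_val_continuous : continuous (set_val : A -> T).
Proof. exact: initial_continuous. Qed.

Lemma set_val_exists x : A x -> exists a : A, set_val a = x.
Proof. by move=> Ax; exists (exist _ x (mem_set Ax)). Qed.

Lemma set_val_open (U : set A) : open U ->
  exists2 W, open W & set_val @^-1` W = U.
Proof. by []. Qed.

Lemma set_val_closed (U : set A) : closed U ->
  exists2 W, closed W & set_val @^-1` W = U.
Proof.
move/closed_openC/set_val_open => [W oW WU]; exists (~` W).
  exact: open_closedC.
by rewrite -preimage_setC WU setCK.
Qed.

Lemma set_val_nbhs (a : A) (U : set A) : nbhs a U ->
  exists2 W, nbhs (set_val a) W & set_val @^-1` W `<=` U.
Proof.
rewrite nbhsE => -[V [/set_val_open[W oW <-] Wa] VU].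
by exists W => //; exists W.
Qed.

Lemma set_val_inj : injective (set_val : A -> T).
Proof. exact: val_inj. Qed.

Lemma set_val_image_preimage C : C `<=` A -> set_val @` (set_val @^-1` C : set A) = C.
Proof.
move=> CA; apply/seteqP; split=> [_ [a Ca <-]//|x Cx].
by have [a ax] := set_val_exists (CA x Cx); exists a => //=; rewrite ax.
Qed.

Lemma set_val_preimage_image (B : set A) : set_val @^-1` (set_val @` B) = B.
Proof.
apply/seteqP; split=> [a [b Bb /set_val_inj <-]//|a Ba].
by exists a.
Qed.

Lemma set_val_preimage_connected C : C `<=` A -> connected C ->
  connected (set_val @^-1` C : set A).
Proof.
move=> CA cC B [b Bb] [_ /set_val_open[V oV <-] BV] [_ /set_val_closed[W cW <-] BW].
have E U : B = set_val @^-1` C `&` set_val @^-1` U -> set_val @` B = C `&` U.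
  by move=> ->; rewrite -preimage_setI set_val_image_preimage // => x [/CA].
rewrite -(set_val_preimage_image B) (cC (set_val @` B)) //.
- by exists (set_val b), b.
- by exists V => //; exact: E.
- by exists W => //; exact: E.
Qed.

Lemma set_val_image_connected (B : set A) : connected B ->
  connected (set_val @` B).
Proof.
move=> cB; apply: connected_continuous_connected => //.
by apply: continuous_subspaceT; exact: set_val_continuous.
Qed.

Lemma set_val_image_compact (B : set A) : compact B -> compact (set_val @` B).
Proof.
move=> cB; apply: continuous_compact => //.
by apply: continuous_subspaceT; exact: set_val_continuous.
Qed.

Lemma set_type_hausdorff : hausdorff_space T -> hausdorff_space A.
Proof.
move=> hT a b ab; apply: set_val_inj; apply: hT => U V aU bV.
have [c [Uc Vc]] := ab _ _ (set_val_continuous aU) (set_val_continuous bV).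
by exists (set_val c).
Qed.

Lemma set_type_compact : compact A -> compact [set: A].
Proof.
move=> cA F PF _.
pose G := set_val @ F.
have GA : G A by apply: (@filterE _ F) => a; exact: set_valP.
have [x [Ax clx]] := cA G _ GA.
have [a ax] := set_val_exists Ax; exists a; split=> // U V FU aV.
have [W aW WV] := set_val_nbhs aV; rewrite ax in aW.
have GU : G (set_val @` U) by apply: (@filterS _ F _ U) FU => b Ub; exists b.
have [_ [[b Ub <-] Wb]] := clx _ _ GU aW.
by exists b; split=> //; exact: WV.
Qed.

Lemma set_type_second_countable : @second_countable T -> @second_countable A.
Proof.
move=> [B cB [Bo Bb]]; exists [set set_val @^-1` U | U in B].
  exact: (sub_countable (card_image_le _ _)).
split=> [_ [U /Bo oU <-]|a U aU]; first by exists U.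
have [W aW WU] := set_val_nbhs aU.
have [V [BV Va] VW] := Bb _ _ aW.
exists (set_val @^-1` V); first by split=> //; exists V.
by move=> b Vb; apply: WU; exact: VW.
Qed.
End SetVal.

(** Neighbourhoods need not be open: the component of an open set at a point is
    a neighbourhood of each of its points. *)
Lemma locally_connected_weak (X : topologicalType) :
  (forall (x : X) U, nbhs x U ->
     exists V, [/\ connected V, V `<=` U & nbhs x V]) -> locally_connected X.
Proof.
move=> H x U xU; have Ux : U^° x by [].
exists (connected_component U^° x); split.
- rewrite openE => z Wz.
  have Uz : nbhs z U^° by apply: nbhs_interior; exact: connected_component_sub Wz.
  have [V [cV VU zV]] := H z _ Uz.
  have Vz := nbhs_singleton zV; apply: filterS zV.
  by rewrite (same_connected_component Wz); exact: connected_component_max.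
- exact: connected_component_refl.
- by move=> z /connected_component_sub /interior_subset.
- exact: component_connected.
Qed.

Section PeanoCriterion.
Variables (R : realType) (Y : topologicalType).
Hypothesis hY : hausdorff_space Y.
Hypothesis cY : compact [set: Y].
Variable d : Y -> Y -> R.
Hypothesis cd : compatible_metric d.

Lemma compatible_ball_nbhs x r : 0 < r -> nbhs x [set y | d x y < r].
Proof. by move=> r0; case: cd => _ _ _ _ /(_ x) -> ; exists r. Qed.

Lemma compatible_ball_open x r : open [set y | d x y < r].
Proof.
rewrite openE => y /= yr; case: cd => _ _ _ tr nb.
apply/nb; exists (r - d x y); first by rewrite subr_gt0.
by move=> z /=; rewrite ltrBrDl; apply: le_lt_trans; exact: tr.
Qed.

Lemma compatible_cball_closed x r : closed [set y | d x y <= r].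
Proof.
rewrite -openC openE => y /= /negP; rewrite -ltNge => yr.
case: cd => _ _ sy tr nb; apply/nb; exists (d x y - r); first by rewrite subr_gt0.
move=> z /= yz; apply/negP; rewrite -ltNge.
by have := tr z x y; rewrite (sy z y); lra.
Qed.

(** Large components of the whole space are finitely many.  For the local
    connectedness of a component [Z] at [z], let [F] be the trace on [Z] of a
    closed ball.  By boundary bumping, every component of [F] that comes close to
    [z] and does not contain [z] leaves the ball, so it is large.  These
    components are finitely many, their union is closed and does not contain
    [z], and therefore the component of [F] at [z] is a neighbourhood of [z]. *)
Theorem peano_criterion :
  (forall F, closed F -> forall c, 0 < c ->
     finite_set [set C | components F C /\
       exists y z, [/\ C y, C z & c <= d y z]]) ->
  peano_compactum R Y.
Proof.
move=> fin; have [d0 _ sy tr nb] := cd; split=> //; last first.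
  exists d => // c c0; apply: sub_finite_set (fin setT closedT c c0).
  move=> C [CC /ereal_sup_gt[_ [[y z] [Cy Cz] <-]]].
  by rewrite lte_fin => /ltW dyz; split=> //; exists y, z.
move=> _ [z0 _ <-]; set Z := connected_component _ z0.
have cZ : closed Z by exact: component_closed.
have nZ : connected Z by exact: component_connected.
apply: locally_connected_weak => a U aU.
have [W zW WU] := set_val_nbhs aU; set z := set_val a in zW.
have Zz : Z z by exact: set_valP.
have [r r0 rW] := (iffLR (nb z W)) zW.
have e0 : 0 < r / 2 by rewrite divr_gt0.
set e := r / 2 in e0.
pose F := Z `&` [set y | d z y <= e].
have cF : closed F by apply: closedI => //; exact: compatible_cball_closed.
have Fz : F z by split=> //=; rewrite d0 ltW.
pose C := connected_component F z.
have Cz : C z by exact: connected_component_refl.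
have e20 : 0 < e / 2 by rewrite divr_gt0.
(* The components of F that come close to z without containing it belong to G. *)
pose G := [set C' | (components F C' /\
       exists y z, [/\ C' y, C' z & e / 2 <= d y z]) /\ ~ C' z].
have finG : finite_set G by apply: sub_finite_set (fin F cF _ e20) => C' [].
have cG : closed (\bigcup_(C' in G) C').
  by apply: closed_bigcup => // C' [[[y _ <-] _] _]; exact: component_closed.
exists (set_val @^-1` C); split.
- apply: set_val_preimage_connected; last exact: component_connected.
  by move=> y /connected_component_sub[].
- move=> b /connected_component_sub[_ /= dzb]; apply: WU; apply: rW => /=.
  by apply: le_lt_trans dzb _; rewrite /e; lra.
- pose N := ~` (\bigcup_(C' in G) C') `&` [set y | d z y < e / 2].
  have zN : nbhs z N.
    apply: filterI; last exact: compatible_ball_nbhs.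
    apply: open_nbhs_nbhs; split; first exact: closed_openC.
    by move=> [C' [_ nC'z] /nC'z].
  have aN : nbhs a (set_val @^-1` N) by exact: set_val_continuous.
  apply: filterS aN => b [nGb /= zb]; set y := set_val b in nGb zb *.
  have Zy : Z y by exact: set_valP.
  apply: contrapT => nCy; apply: nGb.
  have Fy : F y by split=> //=; rewrite (le_trans (ltW zb)) //; lra.
  have Cyy : connected_component F y y by exact: connected_component_refl.
  exists (connected_component F y) => //; split; last first.
    by move=> /connected_component_sym.
  split; first by exists y.
  have [w [yw zw]] : exists w, connected_component F y w /\ ~ d z w < e.
    apply: contrapT => nw; apply: nCy.
    have ZO : Z `<=` [set y | d z y < e].
      apply: (connected_sub_component_nbhs hY cY (G := F) (x := y)) => //.
      - by move=> ? [].
      - exact: compatible_ball_open.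
      - by move=> w yw; apply: contrapT => ?; apply: nw; exists w.
      - by move=> w [Zw /= /ltW].
    apply: connected_component_max Zy => //.
    by move=> w Zw; split=> //=; rewrite ltW //; exact: ZO.
  exists y, w; split=> //; move: zw => /negP; rewrite -leNgt => zw.
  have := tr y z w; lra.
Qed.
End PeanoCriterion.

(** * Components of fibres *)

Lemma ultra_limit (I : Type) (X : topologicalType) (F : set_system I)
    (a : I -> X) : UltraFilter F -> compact [set: X] ->
  exists x : X, a @ F --> x.
Proof.
move=> FU cX; have [|x [_ clx]] := cX (a @ F) _; first exact: filterT.
exists x => V xV; have [//|nV] := in_ultra_setVsetC (a @^-1` V) FU.
by have [z []] := clx (~` V) V nV xV.
Qed.

Lemma open_disjoint_separated (T : topologicalType) (U V : set T) :
  open U -> open V -> U `&` V = set0 -> separated U V.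
Proof.
move=> oU oV UV; split; rewrite -subset0 => z [].
  move=> clU Vz; have [w] := clU V (open_nbhs_nbhs (conj oV Vz)).
  by rewrite UV.
move=> Uz clV; have [w [Vw Uw]] := clV U (open_nbhs_nbhs (conj oU Uz)).
by have : (U `&` V) w by []; rewrite UV.
Qed.

Section FiberComponents.
Variables (X Q : topologicalType) (g : X -> Q).
Hypothesis hX : hausdorff_space X.
Hypothesis cX : compact [set: X].
Hypothesis hQ : hausdorff_space Q.
Hypothesis cg : continuous g.

Definition fiber_component x : set X :=
  connected_component (g @^-1` [set g x]) x.
Definition fiber_components : set (set X) := range fiber_component.

Lemma fiber_component_refl x : fiber_component x x.
Proof. exact: connected_component_refl. Qed.

Lemma fiber_componentE x y : fiber_component x y -> g y = g x.
Proof. by move=> /connected_component_sub. Qed.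

Lemma fiber_component_eq x y : fiber_component x y ->
  fiber_component y = fiber_component x.
Proof.
move=> xy; rewrite /fiber_component (fiber_componentE xy).
exact/esym/same_connected_component.
Qed.

Lemma fiber_closed c : closed (g @^-1` [set c]).
Proof.
apply: preimage_closed => //.
exact/accessible_closed_set1/hausdorff_accessible.
Qed.

Lemma fiber_component_closed x : closed (fiber_component x).
Proof. exact/component_closed/fiber_closed. Qed.

Lemma same_element_fiber x y :
  same_element fiber_components x y <-> fiber_component x y.
Proof.
split=> [/asboolP /(_ (fiber_component x))[|+ _]|xy].
- by exists x.
- by apply; exact: fiber_component_refl.
apply/asboolP => _ [z _ <-]; split=> h.
  by rewrite -(fiber_component_eq h).
by rewrite -(fiber_component_eq h) (fiber_component_eq xy); exact: fiber_component_refl.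
Qed.

(** Two components of a fibre are separated by a clopen part of the fibre.
    Disjoint neighbourhoods of this part and of its complement cover the fibres
    nearby, because [g] is a closed map. *)
Lemma fiber_component_separate x y : g x = g y -> ~ fiber_component x y ->
  exists V U W, [/\ open V /\ V (g x), open U /\ U x, open W /\ W y,
    U `&` W = set0 & g @^-1` V `<=` U `|` W].
Proof.
move=> gxy nxy; set F := g @^-1` [set g x].
have cF : closed F by exact: fiber_closed.
have oy : open (~` [set y]).
  exact/closed_openC/accessible_closed_set1/hausdorff_accessible.
(* A clopen part of the fibre that contains x and not y. *)
have [|E [cE cFE EF Ex Ey]] := component_relclopen hX cX cF (erefl _ : F x) oy.
  by move=> z xz zy; apply: nxy; rewrite -zy.
have [|U [W [oU oW EU FW UW]]] := separate_closed hX cX cE cFE.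
  by rewrite -subset0 => z [Ez []].
have clg := compact_closed_map cX hQ cg.
exists [set c | forall z, g z = c -> (U `|` W) z], U, W; split.
- split; first by apply: open_fiber_sub => //; exact: openU.
  move=> z zx; have [Ez|nEz] := pselect (E z); [left|right].
    exact: EU.
  exact: FW.
- by split=> //; exact: EU.
- split=> //; apply: FW; split; first by rewrite /F /= gxy.
  by move=> /Ey; apply.
- by [].
- by move=> z /= zV; exact: zV.
Qed.

Lemma fiber_component_open_neg x y : ~ fiber_component x y ->
  exists U W, [/\ nbhs x U, nbhs y W &
    forall x' y', U x' -> W y' -> ~ fiber_component x' y'].
Proof.
move=> nxy; have [gxy|gxy] := pselect (g x = g y).
  have [V [U [W [[oV Vx] [oU Ux] [oW Wy] UW VUW]]]] :=
    fiber_component_separate gxy nxy.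
  exists (U `&` g @^-1` V), W; split.
  - apply: filterI; first exact: open_nbhs_nbhs.
    by apply: cg; exact: open_nbhs_nbhs.
  - exact: open_nbhs_nbhs.
  - move=> x' y' [Ux' Vx'] Wy' xy'.
    have := @connected_subset _ _ _ (fiber_component x')
      (open_disjoint_separated oU oW UW).
    case=> [z /fiber_componentE zx'|||sub].
    + by apply: VUW; rewrite /= zx'.
    + exact: component_connected.
    + move=> sub; have : (U `&` W) y' by split=> //; exact: sub.
      by rewrite UW.
    + have : (U `&` W) x' by split=> //; exact/sub/fiber_component_refl.
      by rewrite UW.
move: hQ; rewrite open_hausdorff => /(_ (g x) (g y)) [|[A B] /=].
  exact/eqP.
rewrite !inE => -[Ax By] [oA oB AB].
exists (g @^-1` A), (g @^-1` B); split.
- by apply: cg; exact: open_nbhs_nbhs.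
- by apply: cg; exact: open_nbhs_nbhs.
- move=> x' y' /= Ax' By' /fiber_componentE yx.
  have [sAB _] := iffLR (seteqP _ _) AB.
  by apply: (sAB (g x')); split=> //; rewrite -yx.
Qed.

(** The relation is closed because its complement is open, by
    [fiber_component_open_neg]. *)
Lemma fiber_components_usc : usc_decomposition fiber_components.
Proof.
split.
- split.
  + apply/seteqP; split=> // x _; exists (fiber_component x); first by exists x.
    exact: fiber_component_refl.
  + move=> _ _ [x _ <-] [y _ <-] [z [xz yz]].
    by rewrite -(fiber_component_eq xz) -(fiber_component_eq yz).
  + by move=> _ [x _ <-]; exists x; exact: fiber_component_refl.
- move=> _ [x _ <-]; split; last exact: component_connected.
  exact/(closed_compactT cX)/fiber_component_closed.
- rewrite -openC openE => -[x y] /= nxy.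
  have [|U [W [xU yW UW]]] := @fiber_component_open_neg x y.
    by move=> /same_element_fiber.
  exists (U, W) => // -[x' y'] [/= Ux' Wy'] /same_element_fiber.
  exact: UW.
Qed.

Hypothesis parallel : forall (F : set_system nat) (N : nat -> set X)
    (a b : nat -> X) x y, UltraFilter F -> \oo `<=` F ->
  (forall i, closed (N i)) -> (forall i, connected (N i)) ->
  (forall i j, i != j -> N i `&` N j = set0) ->
  (forall i, N i (a i)) -> (forall i, N i (b i)) ->
  a @ F --> x -> b @ F --> y -> g x = g y.

Variable R : realType.
Local Notation Y := (decomposition_quotient fiber_components).
Local Notation q := (@usc_pi _ fiber_components).

(** An infinite set of large components pulls back to disjoint continua [N i] of
    [X], with points [a i] and [b i] whose images are at distance at least [c].
    Their limits [x] and [y] along an ultrafilter are in different components of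
    fibres, and in the same fibre by [parallel].  Separate these two components
    as in [fiber_component_separate]: either some [N i] is covered by the two
    open sets and meets both, which is absurd, or almost all [N i] contain a
    point [e i] whose image is not in [V], and then [a] and [e] contradict
    [parallel]. *)
Lemma fiber_components_finite (d : Y -> Y -> R) : compatible_metric d ->
  forall F, closed F -> forall c, 0 < c ->
    finite_set [set C | components F C /\
      exists y z, [/\ C y, C z & c <= d y z]].
Proof.
move=> cd F cF c c0; apply: contrapT; set S := [set C | _].
move=> /infiniteP /card_leP[f0].
pose f i := set_val (f0 (exist _ i (mem_set (I : [set: nat] i)))).
have uD := fiber_components_usc.
have Sf i : S (f i) by exact: set_valP.
have finj i j : f i = f j -> i = j.
  move=> /val_inj fij.
  by have /(congr1 set_val) := @inj _ _ _ f0 _ _ (mem_set I) (mem_set I) fij.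
have cqc := @usc_pi_continuous _ fiber_components.
pose N i := q @^-1` (f i).
have cf i : closed (f i) /\ connected (f i).
  have [[y _ <-] _] := Sf i.
  by split; [exact: component_closed|exact: component_connected].
have cN i : closed (N i).
  by apply: preimage_closed; [move=> ? _; exact: cqc|case: (cf i)].
have nN i : connected (N i).
  apply: monotone_preimage_connected; try by case: (cf i).
  - exact: usc_pi_closed.
  - exact: usc_pi_surj.
  - exact: usc_fiber_connected.
have dN i j : i != j -> N i `&` N j = set0.
  move=> ij; rewrite -subset0 => x [/= xi xj].
  move/eqP: ij; apply; apply: finj.
  have [[y _ yi] _] := Sf i; have [[z _ zj] _] := Sf j.
  move: xi xj; rewrite /N /= -yi -zj => xi xj.
  by rewrite (same_connected_component xi) (same_connected_component xj).
have ab i : exists p : X * X, [/\ N i p.1, N i p.2 & c <= d (q p.1) (q p.2)].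
  have [_ [y [z [fy fz yz]]]] := Sf i.
  have [x xy] := usc_pi_surj y; have [w wz] := usc_pi_surj z.
  by exists (x, w); rewrite /N /= xy wz.
have [p pP] := choice ab.
pose a i := (p i).1; pose b i := (p i).2.
have Na i : N i (a i) by case: (pP i).
have Nb i : N i (b i) by case: (pP i).
have dab i : c <= d (q (a i)) (q (b i)) by case: (pP i).
have [U [UU ooU]] := @ultraFilterLemma nat \oo _.
have [x ax] := ultra_limit a UU cX.
have [y bY] := ultra_limit b UU cX.
have gxy : g x = g y by exact: (parallel UU ooU cN nN dN Na Nb ax bY).
have [d0 _ sy tr nb] := cd.
have dxy : c <= d (q x) (q y).
  rewrite leNgt; apply/negP => dc.
  pose r := (c - d (q x) (q y)) / 2.
  have r0 : 0 < r by rewrite divr_gt0 // subr_gt0.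
  have near_lim z (e : nat -> X) : e @ U --> z ->
      U [set i | d (q z) (q (e i)) < r].
    move=> ez; have zr : nbhs z (q @^-1` [set w | d (q z) w < r]).
      by apply: cqc; exact: compatible_ball_nbhs.
    exact: (ez _ zr).
  have [i [/= ai bi]] :=
    @filter_ex _ U _ _ (filterI (near_lim _ _ ax) (near_lim _ _ bY)).
  have := dab i; have := tr (q x) (q (a i)) (q (b i)).
  have := tr (q y) (q x) (q (b i)); rewrite (sy (q (a i)) (q x)).
  by move: ai bi; rewrite /r; lra.
have nxy : ~ fiber_component x y.
  move=> xy; move: dxy; suff -> : q x = q y by rewrite d0 leNgt c0.
  by apply/usc_piE/same_element_fiber.
have [V [A [W [[oV Vx] [oA Ax] [oW Wy] AW VAW]]]] :=
  fiber_component_separate gxy nxy.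
have [inV|ninV] := in_ultra_setVsetC [set i | N i `<=` g @^-1` V] UU.
  have aA : U [set i | A (a i)] by exact: (ax _ (open_nbhs_nbhs (conj oA Ax))).
  have bW : U [set i | W (b i)] by exact: (bY _ (open_nbhs_nbhs (conj oW Wy))).
  have [i [/= NV [aAi bWi]]] :=
    @filter_ex _ U _ _ (filterI inV (filterI aA bW)).
  have dAW z : A z -> W z -> False.
    by move=> Az Wz; have : (A `&` W) z by []; rewrite AW.
  have [|||sub] := @connected_subset _ _ _ (N i)
      (open_disjoint_separated oA oW AW).
  - by move=> z /NV; exact: VAW.
  - exact: nN.
  - by move=> sub; apply: (dAW (b i)) => //; exact: sub.
  - by apply: (dAW (a i)) => //; exact: sub.
have eP i : exists e, N i e /\ (~ (N i `<=` g @^-1` V) -> ~ V (g e)).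
  have [NV|nNV] := pselect (N i `<=` g @^-1` V); first by exists (a i).
  apply: contrapT => h; apply: nNV => z Nz; apply: contrapT => nVz.
  by apply: h; exists z.
have [e eN] := choice eP.
have [z ez] := ultra_limit e UU cX.
have gxz : g x = g z.
  by apply: (parallel UU ooU cN nN dN Na _ ax ez) => i; case: (eN i).
have eV : U [set i | V (g (e i))].
  have zV : nbhs z (g @^-1` V).
    by apply: cg; rewrite -gxz; exact: open_nbhs_nbhs.
  exact: (ez _ zV).
have [i [/= nNi Vi]] := @filter_ex _ U _ _ (filterI ninV eV).
by case: (eN i) => _ /(_ nNi).
Qed.

Theorem fiber_components_peano : @second_countable X ->
  peano_compactum R Y.
Proof.
move=> sX; have uD := fiber_components_usc.
have hY := usc_quotient_hausdorff hX cX uD.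
have cY : compact [set: Y] by exact: usc_quotient_compact.
have [|d cd] := @compact_metrizable R Y hY cY.
  apply: (@closed_map_second_countable X Y q) => //.
    exact: usc_pi_continuous.
  exact: usc_pi_surj.
by apply: (peano_criterion hY cY cd) => F cF c; exact: fiber_components_finite.
Qed.
End FiberComponents.

(** * Three continua joining two continua *)

Section Planar.
Variables (R : realType) (T : topologicalType).
Hypothesis hT : hausdorff_space T.
Hypothesis cT : compact [set: T].
Hypothesis lT : locally_connected T.

Lemma connected_nbhs_closure (z : T) A : open A -> A z ->
  exists V, [/\ open V, V z, connected V & closure V `<=` A].
Proof.
move=> oA Az.
have [|B zB BA] := compact_regular hT cT _ (open_nbhs_nbhs (conj oA Az)).
  exact: filterT.
have [V [oV Vz VB cV]] := lT zB.
by exists V; split=> //; apply: subset_trans BA; exact: closureS.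
Qed.

(** The relation of being joined by a continuum in [B] is an equivalence relation
    on [B] with open classes, and the connected set [A] meets only one class. *)
Lemma connected_compact_between A B x y : open B -> A `<=` B -> connected A ->
  A x -> A y -> exists E : set T, [/\ closed E, connected E, E `<=` B, E x & E y].
Proof.
move=> oB AB cA Ax Ay.
pose r z z' := exists E : set T, [/\ closed E, connected E, E `<=` B, E z & E z'].
have rsym z z' : r z z' -> r z' z by move=> [E [? ? ? ? ?]]; exists E.
have rtr z z' z'' : r z z' -> r z' z'' -> r z z''.
  move=> [E [cE nE EB Ez Ez']] [F [cF nF FB Fz Fz']].
  exists (E `|` F); split; [exact: closedU| | |by left|by right].
    by apply: connectedU => //; exists z'.
  by move=> t [/EB|/FB].
(* Closures of small connected neighbourhoods are continua. *)
have rnb z : B z -> exists V, [/\ open V, V z, V `<=` B &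
    forall z', V z' -> r z z'].
  move=> Bz; have [V [oV Vz cV VB]] := connected_nbhs_closure oB Bz.
  exists V; split=> // [t Vt|t Vt]; first exact/VB/subset_closure.
  exists (closure V); split=> //; try exact: subset_closure.
    exact: closed_closure.
  exact: connected_closure.
pose C := B `&` [set z | r x z].
pose C' := B `&` [set z | ~ r x z].
have oC : open C.
  rewrite openE => z [Bz xz]; have [V [oV Vz VB rV]] := rnb z Bz.
  apply: (@filterS _ _ _ V); last exact: open_nbhs_nbhs.
  by move=> t Vt; split; [exact: VB|exact: rtr xz (rV t Vt)].
have oC' : open C'.
  rewrite openE => z [Bz nxz]; have [V [oV Vz VB rV]] := rnb z Bz.
  apply: (@filterS _ _ _ V); last exact: open_nbhs_nbhs.
  move=> t Vt; split; first exact: VB.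
  by move=> xt; apply: nxz; apply: rtr xt _; apply: rsym; exact: rV.
suff ACE : A `&` C = A by move: Ay; rewrite -ACE => -[_ []].
apply: cA.
- exists x; split=> //; split; first exact: AB.
  by have [V [_ Vx _ /(_ _ Vx)]] := rnb x (AB x Ax).
- by exists C.
- exists (~` C'); first exact: open_closedC.
  apply/seteqP; split=> z [Az]; first by move=> [_ xz]; split=> // -[_ []].
  move=> nC'; split=> //; split; first exact: AB.
  by apply: contrapT => nxz; apply: nC'; split=> //; exact: AB.
Qed.

Variables (w : T) (m : T -> R * R).
Hypothesis mc : forall x, x <> w -> {for x, continuous m}.
Hypothesis minj : forall x y, x <> w -> y <> w -> m x = m y -> x = y.

(** The map [m] stands for a chart of the sphere minus the point [w]. *)
Theorem no_planar_K33 (p n : 'I_3 -> T) (E : 'I_3 -> 'I_3 -> set T) :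
  (forall k i, closed (E k i)) -> (forall k i, connected (E k i)) ->
  (forall k i, ~ E k i w) ->
  (forall k i, E k i (p k)) -> (forall k i, E k i (n i)) ->
  (forall k l i j, k != l -> i != j -> E k i `&` E l j = set0) -> False.
Proof.
move=> cE nE wE Ep En EE.
have mE k i : {within E k i, continuous m}.
  apply: continuous_in_subspaceT => x; rewrite inE => Ex; apply: mc => xw.
  by apply: (wE k i); rewrite -xw.
apply: (@no_K33 R (m \o p) (m \o n) (fun k i => m @` E k i)).
- by move=> k i; apply: continuous_compact => //; exact: closed_compactT.
- by move=> k i; apply: connected_continuous_connected.
- by move=> k i; exists (p k).
- by move=> k i; exists (n i).
- move=> k l i j kl ij; rewrite -subset0 => z [[x Ex <-] [y Ey]] xy.
  have : (E k i `&` E l j) x.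
    split=> //; rewrite (minj _ _ (esym xy)) // => h.
      by apply: (wE k i); rewrite -h.
    by apply: (wE l j); rewrite -h.
  by rewrite EE.
Qed.

Lemma closed_bigcup_neq (N : 'I_3 -> set T) i : (forall j, closed (N j)) ->
  closed (\bigcup_(j in [set j | j != i]) N j).
Proof. by move=> cN; apply: closed_bigcup => //; exact: finite_finset. Qed.

(** The three parts [P], [S], [U] and the three continua [N i] would form a graph
    K33.  The vertices on the side of the continua are the points [n i] of
    [crossing_point].  The edges at [P], [S] and [U] are [P `|` B i],
    [S `|` F i] and [A i `|` W i]; here [A i] is a continuum in [U] that reaches
    the small continuum [W i] around [n i], and [B i], [F i] are continua close
    to [N i] leading from [n i] to [P] without meeting [S], respectively to [S]
    without meeting [P].  The auxiliary continua are chosen one after the other,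
    each in the complement of those from which it must be disjoint. *)
Theorem three_crossings (P S U : set T) (N : 'I_3 -> set T) :
  closed P -> connected P -> closed S -> connected S -> P `&` S = set0 ->
  (forall i, closed (N i)) -> (forall i, connected (N i)) ->
  (forall i j, i != j -> N i `&` N j = set0) ->
  (forall i, N i `&` P !=set0) -> (forall i, N i `&` S !=set0) ->
  open U -> connected U -> (forall i, N i `<=` closure U) ->
  U `&` P = set0 -> U `&` S = set0 -> (forall i, U `&` N i = set0) ->
  ~ P w -> ~ S w -> ~ U w -> (forall i, ~ N i w) -> False.
Proof.
move=> cP nP cS nS PS0 cN nN NN0 NP NS oU nU NU UP0 US0 UN0 Pw Sw Uw Nw.
have dis (A B : set T) z : A `&` B = set0 -> A z -> B z -> False.
  by move=> AB Az Bz; have : (A `&` B) z by []; rewrite AB.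
have cw : closed [set w] by exact/accessible_closed_set1/hausdorff_accessible.
have cross i := crossing_point hT cT (cN i) (nN i) cP cS PS0 (NP i) (NS i).
have [n] := choice cross => /choice[C] /choice[D] CD.
have nP' i : ~ P (n i) by case: (CD i) => -[].
have nS' i : ~ S (n i) by case: (CD i) => -[].
have nC i : connected (C i) by case: (CD i) => _ [].
have CN i : C i `<=` N i `\` S by case: (CD i) => _ [].
have Cn i : C i (n i) by case: (CD i) => _ [].
have CP i : C i `&` P !=set0 by case: (CD i) => _ [].
have nD i : connected (D i) by case: (CD i) => _ _ [].
have DN i : D i `<=` N i `\` P by case: (CD i) => _ _ [].
have Dn i : D i (n i) by case: (CD i) => _ _ [].
have DS i : D i `&` S !=set0 by case: (CD i) => _ _ [].
have [p pCP] := choice CP.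
have [s sDS] := choice DS.
have Nn i : N i (n i) by case: (CN i _ (Cn i)).
have Wex i : exists V, [/\ open V, V (n i), connected V & closure V `<=`
    ~` (P `|` S `|` [set w] `|` \bigcup_(j in [set j | j != i]) N j)].
  apply: connected_nbhs_closure.
    apply: closed_openC; apply: closedU; last exact: closed_bigcup_neq.
    by apply: closedU => //; exact: closedU.
  move=> [[[//|//]|nw]|[j ji Nj]]; first exact: nP'.
  - exact: nS'.
  - by apply: (Nw i); rewrite -nw.
  - by apply: (dis (N j) (N i) (n i)) => //; exact: NN0.
have [V VW] := choice Wex.
(* W i avoids P, S, w and the other two continua. *)
pose W i := closure (V i).
have cW i : closed (W i) by exact: closed_closure.
have nW i : connected (W i) by case: (VW i) => _ _ ? _; exact: connected_closure.
have Wn i : W i (n i) by case: (VW i) => _ ? _ _; exact: subset_closure.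
have Wdis i z : W i z -> ~ (P `|` S `|` [set w] `|`
    \bigcup_(j in [set j | j != i]) N j) z.
  by case: (VW i) => _ _ _; exact.
have uex i : exists z, U z /\ V i z.
  have [oV Vn _ _] := VW i.
  by have [z [Uz Vz]] := NU i _ (Nn i) (V i) (open_nbhs_nbhs (conj oV Vn)); exists z.
have [u uUV] := choice uex.
have Uu i : U (u i) by case: (uUV i).
have Wu i : W i (u i) by case: (uUV i) => _ ?; exact: subset_closure.
have [A AP] := choice (fun i => connected_compact_between oU (@subset_refl _ U) nU
  (Uu 0) (Uu i)).
have cA i : closed (A i) by case: (AP i).
have nA i : connected (A i) by case: (AP i).
have AU i : A i `<=` U by case: (AP i).
have A0 i : A i (u 0) by case: (AP i).
have Au i : A i (u i) by case: (AP i).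
(* B i joins n i to P, away from S, w and the parts with another index. *)
have Bex i : exists E : set T, [/\ closed E, connected E, E `<=` ~` (S `|` [set w] `|`
    \bigcup_(j in [set j | j != i]) (N j `|` W j) `|` \bigcup_j A j),
    E (n i) & E (p i)].
  apply: (connected_compact_between _ _ (nC i)) => //; last by case: (pCP i).
    apply: closed_openC; apply: closedU; last first.
      by apply: closed_bigcup => //; exact: finite_finset.
    apply: closedU; first exact: closedU.
    by apply: closed_bigcup_neq => j; exact: closedU.
  move=> z /CN[Nz nSz] [[[//|zw]|[j /= ji [Nj|Wj]]]|[j _ /AU Uz]].
  - by apply: (Nw i); rewrite -zw.
  - by apply: (dis (N j) (N i) z) => //; exact: NN0.
  - by apply: (Wdis j z Wj); right; exists i => //=; rewrite eq_sym.
  - exact: (dis U (N i) z).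
have [B BP] := choice Bex.
have cB i : closed (B i) by case: (BP i).
have nB i : connected (B i) by case: (BP i).
have Bdis i z : B i z -> ~ (S `|` [set w] `|`
    \bigcup_(j in [set j | j != i]) (N j `|` W j) `|` \bigcup_j A j) z.
  by case: (BP i) => _ _ + _ _; exact.
have Bn i : B i (n i) by case: (BP i).
have Bp i : B i (p i) by case: (BP i).
(* F i joins n i to S; it is chosen last, so it also avoids the other B j. *)
have Fex i : exists E : set T, [/\ closed E, connected E, E `<=` ~` (P `|` [set w] `|`
    \bigcup_(j in [set j | j != i]) (B j `|` W j) `|` \bigcup_j A j),
    E (n i) & E (s i)].
  apply: (connected_compact_between _ _ (nD i)) => //; last by case: (sDS i).
    apply: closed_openC; apply: closedU; last first.
      by apply: closed_bigcup => //; exact: finite_finset.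
    apply: closedU; first exact: closedU.
    by apply: closed_bigcup_neq => j; exact: closedU.
  move=> z /DN[Nz nPz] [[[//|zw]|[j /= ji [Bj|Wj]]]|[j _ /AU Uz]].
  - by apply: (Nw i); rewrite -zw.
  - apply: (Bdis j z Bj); left; right; exists i; first by rewrite /= eq_sym.
    by left.
  - by apply: (Wdis j z Wj); right; exists i => //=; rewrite eq_sym.
  - exact: (dis U (N i) z).
have [F FP] := choice Fex.
have cF i : closed (F i) by case: (FP i).
have nF i : connected (F i) by case: (FP i).
have Fdis i z : F i z -> ~ (P `|` [set w] `|`
    \bigcup_(j in [set j | j != i]) (B j `|` W j) `|` \bigcup_j A j) z.
  by case: (FP i) => _ _ + _ _; exact.
have Fn i : F i (n i) by case: (FP i).
have Fs i : F i (s i) by case: (FP i).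
have PF i j : i != j -> (P `|` B i) `&` (S `|` F j) = set0.
  move=> ij; rewrite -subset0 => z [[Pz|Bz] [Sz|Fz]].
  - exact: (dis P S z).
  - by apply: (Fdis j z Fz); do 3 left.
  - by apply: (Bdis i z Bz); do 3 left.
  - by apply: (Fdis j z Fz); left; right; exists i => //; left.
have PA i j : i != j -> (P `|` B i) `&` (A j `|` W j) = set0.
  move=> ij; rewrite -subset0 => z [[Pz|Bz] [Az|Wz]].
  - by apply: (dis U P z) => //; exact: AU Az.
  - by apply: (Wdis j z Wz); do 3 left.
  - by apply: (Bdis i z Bz); right; exists j.
  - apply: (Bdis i z Bz); left; right; exists j; first by rewrite /= eq_sym.
    by right.
have SA i j : i != j -> (S `|` F i) `&` (A j `|` W j) = set0.
  move=> ij; rewrite -subset0 => z [[Sz|Fz] [Az|Wz]].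
  - by apply: (dis U S z) => //; exact: AU Az.
  - by apply: (Wdis j z Wz); left; left; right.
  - by apply: (Fdis i z Fz); right; exists j.
  - apply: (Fdis i z Fz); left; right; exists j; first by rewrite /= eq_sym.
    by right.
pose pick (Z : Type) (a b c : Z) (k : 'I_3) :=
  if val k is k'.+1 then if k' is _.+1 then c else b else a.
have k3 (Z : 'I_3 -> Prop) : Z 0 -> Z 1 -> Z 2 -> forall k, Z k.
  move=> Z0 Z1 Z2 [[|[|[|//]]] h].
  - by rewrite (_ : Ordinal h = 0) //; exact: val_inj.
  - by rewrite (_ : Ordinal h = 1) //; exact: val_inj.
  - by rewrite (_ : Ordinal h = 2) //; exact: val_inj.
apply: (@no_planar_K33 (pick _ (p 0) (s 0) (u 0)) n (fun k i =>
  pick _ (P `|` B i) (S `|` F i) (A i `|` W i) k)).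
- by elim/k3 => i; exact: closedU.
- elim/k3 => i; apply: connectedU => //=.
  + by exists (p i); split=> //; case: (pCP i).
  + by exists (s i); split=> //; case: (sDS i).
  + by exists (u i).
- elim/k3 => i /=.
  + by move=> [//|/Bdis]; apply; left; left; right.
  + by move=> [//|/Fdis]; apply; left; left; right.
  + by move=> [/AU//|/Wdis]; apply; left; right.
- elim/k3 => i /=.
  + by left; case: (pCP 0).
  + by left; case: (sDS 0).
  + by left.
- by elim/k3 => i /=; right.
- elim/k3; elim/k3 => i j // _ ij /=.
  + exact: PF.
  + exact: PA.
  + by rewrite setIC PF // eq_sym.
  + exact: SA.
  + by rewrite setIC PA // eq_sym.
  + by rewrite setIC SA // eq_sym.
Qed.
End Planar.

(** * The topology of the Riemann sphere *)

Section ComplexTopology.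
Variable R : realType.
Local Notation CC := (R[i] : numClosedFieldType).

Definition of_pair (p : R * R) : CC := Complex p.1 p.2.
Definition to_pair (z : CC) : R * R := (complex.Re z, complex.Im z).

Lemma of_pairK : cancel of_pair to_pair. Proof. by case. Qed.
Lemma to_pairK : cancel to_pair of_pair. Proof. by case. Qed.

Lemma of_pair_continuous : continuous of_pair.
Proof.
move=> p U /nbhs_ballP[e /= e0 eU].
have [e1 e2] : complex.Im e = 0 /\ 0 < complex.Re e.
  by move: e0; rewrite ltcE => /andP[/eqP -> ->].
have r0 : 0 < complex.Re e / 2 by rewrite divr_gt0.
exists (ball p.1 (complex.Re e / 2), ball p.2 (complex.Re e / 2)).
  by split; exact: nbhsx_ballx.
move=> [a b] /= [pa pb]; apply: eU; rewrite /ball /= normc_def ltcE /= e1 eqxx /=.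
set x := p.1 - a; set y := p.2 - b.
have {}pa : `|x| < complex.Re e / 2 by [].
have {}pb : `|y| < complex.Re e / 2 by [].
rewrite -(ger0_norm (ltW e2)) -sqrtr_sqr ltr_sqrt ?exprn_gt0 //.
rewrite -(real_normK (num_real x)) -(real_normK (num_real y)).
have := normr_ge0 x; have := normr_ge0 y; nra.
Qed.

Lemma to_pair_continuous : continuous to_pair.
Proof.
move=> z U [[A B] /= [/nbhs_ballP[e e0 eA] /nbhs_ballP[f f0 fB]] ABU].
apply/nbhs_ballP; exists ((Num.min e f)%:C)%C.
  by rewrite /= ltcR lt_min e0.
move=> w; rewrite /ball /= normc_def ltcR lt_min => /andP[we wf].
have sq x y : `|x| <= Num.sqrt (x ^+ 2 + y ^+ 2) :> R.
  by rewrite -sqrtr_sqr ler_wsqrtr // lerDl sqr_ge0.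
apply: ABU; split=> /=.
  by apply: eA; apply: le_lt_trans we; case: (z) (w) => [? ?] [? ?] /=; exact: sq.
apply: fB; apply: le_lt_trans wf; case: (z) (w) => [? ?] [? ?] /=.
by rewrite [_ ^+ 2 + _]addrC; exact: sq.
Qed.

Lemma complex_hausdorff : hausdorff_space CC.
Proof.
move=> z w zw; apply: (can_inj to_pairK).
have hP : hausdorff_space (R * R)%type by exact: norm_hausdorff.
apply: hP => U V zU wV.
have [t [Ut Vt]] := zw _ _ (to_pair_continuous zU) (to_pair_continuous wV).
by exists (to_pair t).
Qed.

Definition box (p : R * R) (r : R) : set (R * R) :=
  [set q | `|p.1 - q.1| <= r /\ `|p.2 - q.2| <= r].

Lemma box_compact_pair p r : compact (box p r).
Proof.
have -> : box p r = `[p.1 - r, p.1 + r] `*` `[p.2 - r, p.2 + r].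
  by apply/seteqP; split=> -[a b] /=; rewrite /box /= !in_itv /= !ler_norml;
    move=> [/andP[? ?] /andP[? ?]]; split; apply/andP; split; lra.
by apply: compact_setX; exact: segment_compact.
Qed.

Lemma box_compact p r : compact (of_pair @` box p r).
Proof.
apply: continuous_compact; last exact: box_compact_pair.
by apply: continuous_subspaceT; exact: of_pair_continuous.
Qed.

Lemma box_nbhs p r : 0 < r -> nbhs (of_pair p) (of_pair @` box p r).
Proof.
move=> r0; have : nbhs (of_pair p) (to_pair @^-1` box p r).
  apply: to_pair_continuous; exists (ball p.1 r, ball p.2 r).
    by split; exact: nbhsx_ballx.
  by move=> q /= [/ltW ? /ltW ?].
by apply: filterS => z zb; exists (to_pair z) => //; exact: to_pairK.
Qed.

Lemma complex_locally_compact : locally_compact [set: CC].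
Proof.
move=> z _; rewrite withinET; exists (of_pair @` box (to_pair z) 1).
  by rewrite -[in X in nbhs X](to_pairK z); exact: box_nbhs.
split; first exact: box_compact.
by apply: compact_closed; [exact: complex_hausdorff|exact: box_compact].
Qed.

Local Notation S := (riemann_sphere R).

Lemma sphere_compact : compact [set: S].
Proof. exact: one_point_compactification_compact. Qed.

Lemma sphere_hausdorff : hausdorff_space S.
Proof.
apply: one_point_compactification_hausdorff.
  exact: complex_locally_compact.
exact: complex_hausdorff.
Qed.

Definition finite_point (p : R * R) : S := Some (of_pair p).
Definition exterior (r : R) : set (R * R) := [set p | r < `|p.1| \/ r < `|p.2|].

Lemma finite_point_inj : injective finite_point.
Proof. by move=> p q [] ? ?; apply: (can_inj of_pairK); congr Complex. Qed.

Lemma sphereP (x : S) : x = None \/ exists p, x = finite_point p.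
Proof.
by case: x => [z|]; [right; exists (to_pair z); rewrite /finite_point to_pairK|left].
Qed.

Lemma finite_point_continuous : continuous finite_point.
Proof.
by move=> p U pU; exact: (@of_pair_continuous p (Some @^-1` U) pU).
Qed.

Lemma finite_point_nbhs p (U : set S) : nbhs (finite_point p) U <->
  nbhs p (finite_point @^-1` U).
Proof.
split; first exact: finite_point_continuous.
case: p => a b pU; change (nbhs (of_pair (a, b)) (Some @^-1` U)).
have : nbhs (of_pair (a, b)) (to_pair @^-1` (finite_point @^-1` U)).
  exact: (@to_pair_continuous (of_pair (a, b)) _ pU).
by apply: filterS => z /=; rewrite /finite_point to_pairK.
Qed.

(** Compact subsets of the plane are bounded, and boxes are compact. *)
Lemma infinity_nbhs (U : set S) : nbhs (None : S) U <->
  U None /\ exists2 r, 0 < r & exterior r `<=` finite_point @^-1` U.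
Proof.
split.
- move=> [A [cA clA] AU]; split; first by apply: AU; right.
  have : compact (to_pair @` A).
    by apply: continuous_compact => //; apply: continuous_subspaceT;
      exact: to_pair_continuous.
  move=> /compact_bounded[M [_ MA]].
  exists (Num.max 1 (M + 1)); first by rewrite lt_max ltr01.
  move=> p pe; apply: AU; left; exists (of_pair p) => // Ap.
  have : `|p| <= Num.max 1 (M + 1).
    apply: MA; first by rewrite lt_max; apply/orP; right; lra.
    by exists (of_pair p) => //; exact: of_pairK.
  by rewrite prod_normE ge_max => /andP[]; case: pe; rewrite ltNge => /negP.
- move=> [UN [r r0 rU]]; exists (of_pair @` box (0, 0) r).
    split; first exact: box_compact.
    by apply: compact_closed; [exact: complex_hausdorff|exact: box_compact].
  move=> x [[z nb <-]|-> //].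
  have := rU (to_pair z); rewrite /= /finite_point to_pairK; apply.
  apply: contrapT => /not_orP[/negP + /negP]; rewrite -!leNgt => a b.
  apply: nb; exists (to_pair z); last exact: to_pairK.
  by rewrite /box /= !sub0r !normrN.
Qed.
End ComplexTopology.

Section PlaneConvex.
Variable R : realType.
Implicit Types (A : set (R * R)) (p q c : R * R) (r s t : R).

Lemma lt_between (k x y t : R) : k < x -> k < y -> 0 <= t <= 1 ->
  k < x + t * (y - x).
Proof.
move=> kx ky /andP[t0 t1]; have [xy|yx] := leP x y.
  have : 0 <= t * (y - x) by rewrite mulr_ge0 // subr_ge0.
  by lra.
have : 0 <= (1 - t) * (x - y) by rewrite mulr_ge0 // subr_ge0 // ltW.
by rewrite mulrBl mul1r !mulrBr; lra.
Qed.

Lemma gt_between (k x y t : R) : x < k -> y < k -> 0 <= t <= 1 ->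
  x + t * (y - x) < k.
Proof.
move=> xk yk t01.
have := @lt_between (- k) (- x) (- y) t; rewrite !ltrN2 => /(_ xk yk t01).
by rewrite !mulrBr !mulrN; lra.
Qed.

Definition plane_convex A := forall p q t, A p -> A q -> 0 <= t <= 1 ->
  A (p.1 + t * (q.1 - p.1), p.2 + t * (q.2 - p.2)).

Lemma plane_convex_connected A : plane_convex A -> connected A.
Proof.
move=> cA; have [[c Ac]|A0] := pselect (A !=set0); last first.
  have -> : A = set0 by rewrite -subset0 => z Az; apply: A0; exists z.
  exact: connected0.
pose g q t : R * R := (c.1 + t * (q.1 - c.1), c.2 + t * (q.2 - c.2)).
have cg q : continuous (g q).
  have line (a b : R) : continuous (fun t : R => a + t * b).
    move=> t; apply: cvgD; first exact: cvg_cst.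
    by apply: cvgM; [exact: cvg_id|exact: cvg_cst].
  move=> t; exact: (cvg_pair (line c.1 (q.1 - c.1) t) (line c.2 (q.2 - c.2) t)).
have -> : A = \bigcup_(q in A) (g q @` `[0, 1]).
  apply/seteqP; split=> [q Aq|_ [q Aq [t t01 <-]]].
    exists q => //; exists 1; first by rewrite /= in_itv /= ler01 lexx.
    by rewrite /g !mul1r !subrKC; case: (q).
  by apply: cA => //; move: t01; rewrite /= in_itv.
apply: bigcup_connected.
  exists c => q Aq; exists 0; first by rewrite /= in_itv /= ler01 lexx.
  by rewrite /g !mul0r !addr0; case: (c).
move=> q Aq; apply: connected_continuous_connected; first exact: segment_connected.
exact: continuous_subspaceT.
Qed.

(** The complement of the box in [A] is the union of four convex sets, one for
    each side of the box; consecutive ones share a corner. *)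
Lemma convex_minus_box_connected A c r s : plane_convex A -> 0 <= r < s ->
  A (c.1 + s, c.2 + s) -> A (c.1 - s, c.2 - s) -> A (c.1 + s, c.2 - s) ->
  connected (A `&` [set p | r < `|p.1 - c.1| \/ r < `|p.2 - c.2|]).
Proof.
move=> cA /andP[r0 rs] App Amm Apm.
pose H1 := A `&` [set p | c.1 + r < p.1].
pose H2 := A `&` [set p | c.2 + r < p.2].
pose H3 := A `&` [set p | p.1 < c.1 - r].
pose H4 := A `&` [set p | p.2 < c.2 - r].
have -> : A `&` [set p | r < `|p.1 - c.1| \/ r < `|p.2 - c.2|] =
    (H1 `|` H2) `|` (H3 `|` H4).
  apply/seteqP; split=> p.
    rewrite /= !ltr_normr => -[Ap]; rewrite /H1 /H2 /H3 /H4 /=.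
    case=> /orP[] h; [left; left|right; left|left; right|right; right]; split=> //;
    lra.
  case=> -[] [Ap] /= h; split=> //=; rewrite !ltr_normr; [left|right|left|right];
    apply/orP; by [left; lra|right; lra].
have cH1 : connected H1.
  apply: plane_convex_connected => p q t [Ap /= hp] [Aq /= hq] t01.
  by split; [exact: cA|exact: lt_between].
have cH2 : connected H2.
  apply: plane_convex_connected => p q t [Ap /= hp] [Aq /= hq] t01.
  by split; [exact: cA|exact: lt_between].
have cH3 : connected H3.
  apply: plane_convex_connected => p q t [Ap /= hp] [Aq /= hq] t01.
  by split; [exact: cA|exact: gt_between].
have cH4 : connected H4.
  apply: plane_convex_connected => p q t [Ap /= hp] [Aq /= hq] t01.
  by split; [exact: cA|exact: gt_between].
apply: connectedU.
- exists (c.1 + s, c.2 - s); split; [left|right]; split=> //=; lra.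
- apply: connectedU => //; exists (c.1 + s, c.2 + s); split; split=> //=; lra.
- apply: connectedU => //; exists (c.1 - s, c.2 - s); split; split=> //=; lra.
Qed.
End PlaneConvex.

Section Sphere.
Variable R : realType.
Local Notation S := (riemann_sphere R).
Local Notation fin := (@finite_point R).

Lemma finite_image_connected (A : set (R * R)) : connected A ->
  connected (fin @` A).
Proof.
move=> cA; apply: connected_continuous_connected => //.
by apply: continuous_subspaceT; exact: finite_point_continuous.
Qed.

Lemma finite_preimage_image (A : set (R * R)) : fin @^-1` (fin @` A) = A.
Proof.
apply/seteqP; split=> [p [q Aq /finite_point_inj <-]//|p Ap].
by exists p.
Qed.

Lemma near_by_convex (p : R * R) r : plane_convex [set q | near_by r p q].
Proof.
have E x y : (`|x - y| < r) = (x - r < y) && (y < x + r) :> bool.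
  by rewrite ltr_norml; apply/idP/idP => /andP[? ?]; apply/andP; split; lra.
move=> q q' t; rewrite /= /near_by !E /=.
move=> /andP[/andP[? ?] /andP[? ?]] /andP[/andP[? ?] /andP[? ?]] t01.
by rewrite !lt_between // !gt_between.
Qed.

Lemma exterior_connected (r : R) : 0 <= r -> connected (@exterior R r).
Proof.
move=> r0; pose c : R * R := (0, 0).
have -> : exterior r = [set: R * R] `&`
    [set p | r < `|p.1 - c.1| \/ r < `|p.2 - c.2|].
  by rewrite setTI; apply/seteqP; split=> p; rewrite /exterior /= !subr0.
by apply: (@convex_minus_box_connected _ setT c r (r + 1)) => //;
  apply/andP; split; lra.
Qed.

Definition infinity_disk (r : R) : set S := None |` fin @` exterior r.

Lemma infinity_disk_nbhs r : 0 < r -> nbhs (None : S) (infinity_disk r).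
Proof.
move=> r0; apply/infinity_nbhs; split; first by left.
by exists r => // p pe; right; exists p.
Qed.

(** The point at infinity is adherent to the connected exterior of a box. *)
Lemma infinity_disk_connected r : 0 < r -> connected (infinity_disk r).
Proof.
move=> r0; apply: (@connected_between _ (fin @` exterior r)).
- exact/finite_image_connected/exterior_connected/ltW.
- by move=> x; right.
- move=> x [->|]; last exact: subset_closure.
  move=> U /infinity_nbhs[_ [e e0 eU]].
  exists (fin (r + e, 0)); split.
    by exists (r + e, 0) => //; left; rewrite /= ger0_norm; lra.
  by apply: eU; left; rewrite /= ger0_norm; lra.
Qed.

Lemma sphere_locally_connected : locally_connected S.
Proof.
apply: locally_connected_weak => x U.
have [->|[p ->]] := sphereP x.
  move=> NU; have [UN [r r0 rU]] := iffLR (infinity_nbhs _) NU.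
  exists (infinity_disk r); split.
  - exact: infinity_disk_connected.
  - by move=> y [->//|[q /rU qU <-]].
  - exact: infinity_disk_nbhs.
move=> /finite_point_nbhs /near_by_nbhs[r r0 rU].
exists (fin @` [set q | near_by r p q]); split.
- exact/finite_image_connected/plane_convex_connected/near_by_convex.
- by move=> _ [q /rU qU <-].
- by apply/finite_point_nbhs; rewrite finite_preimage_image;
    apply/near_by_nbhs; exists r.
Qed.

Lemma open_has_finite_point (U : set S) : open U -> U !=set0 ->
  exists p, U (fin p).
Proof.
move=> oU [x Ux]; have xU : nbhs x U by exact: open_nbhs_nbhs.
have [xN|[p xp]] := sphereP x; last by exists p; rewrite -xp.
move: xU; rewrite xN => /infinity_nbhs[_ [r r0 rU]].
by exists (r + 1, 0); apply: rU; left; rewrite /= ger0_norm; lra.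
Qed.

(** In a separation of the punctured set, the connected set [V `\ w] lies on one
    side.  The point [w] can be added to this side, and [U] would be separated. *)
Lemma punctured_connected (T : topologicalType) (U V : set T) w :
  hausdorff_space T -> connected U -> nbhs w V -> V `<=` U ->
  connected (V `\ w) -> connected (U `\ w).
Proof.
move=> hT cU wV VU cV; apply/connectedP => E [E0 UE sE].
have Uw : U w by apply: VU; exact: nbhs_singleton.
wlog VE : E E0 UE sE / V `\ w `<=` E false.
  move=> H; have := connected_subset sE; rewrite -UE => /(_ (V `\ w)).
  case=> //.
  - by move=> z [/VU].
  - exact: H.
  - by apply: (H (E \o negb)) => //=; [rewrite setUC|rewrite separatedC].
have nE b : ~ E b w.
  move=> Ebw; have [_] : (U `\ w) w by rewrite UE; case: b Ebw; [right|left].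
  by apply.
move/connectedP: cU => /(_ (fun b => if b then E true else w |` E false)).
apply; split.
- by case=> //; exists w; left.
- rewrite -setUA -UE; apply/seteqP; split=> [z Uz|z [->//|[]//]].
  by have [->|zw] := pselect (z = w); [left|right].
- have cw : closed [set w] by exact/accessible_closed_set1/hausdorff_accessible.
  have [s1 s2] := sE.
  have V1 z : V z -> E true z -> False.
    move=> Vz E1; have E0z : E false z.
      by apply: VE; split=> // zw; apply: (nE true); rewrite -zw.
    have : (closure (E false) `&` E true) z by split=> //; exact: subset_closure.
    by rewrite s1.
  split.
  + rewrite closureU -(iffLR (closure_id _) cw) setIUl s1 setU0 -subset0.
    by move=> z [-> /nE].
  + rewrite setIUl s2 setU0 -subset0 => z [-> clw].
    by have [t [E1 Vt]] := clw V wV; exact: V1 Vt E1.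
Qed.

Lemma sphere_punctured_connected (U : set S) (p : R * R) : open U ->
  connected U -> U (fin p) -> connected (U `\ (fin p)).
Proof.
move=> oU cU Up.
have := open_nbhs_nbhs (conj oU Up) => /finite_point_nbhs /near_by_nbhs[r r0 rU].
apply: (@punctured_connected _ _ (fin @` [set q | near_by r p q])) => //.
- exact: sphere_hausdorff.
- by apply/finite_point_nbhs; rewrite finite_preimage_image;
    apply/near_by_nbhs; exists r.
- by move=> _ [q /rU qU <-].
- have -> : (fin @` [set q | near_by r p q]) `\ (fin p) =
      fin @` ([set q | near_by r p q] `&`
        [set q | 0 < `|q.1 - p.1| \/ 0 < `|q.2 - p.2|]).
    apply/seteqP; split=> x.
      move=> [[q pq <-] qp]; exists q => //; split=> //=.
      apply: contrapT => /not_orP[]; rewrite !normr_gt0 !subr_eq0.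
      move=> /negP; rewrite negbK => /eqP a /negP; rewrite negbK => /eqP b.
      by apply: qp; congr fin; case: (q) (p) a b => [? ?] [? ?] /= -> ->.
    move=> [q [pq h] <-]; split; first by exists q.
    by move=> /finite_point_inj qp; move: h => /=; rewrite qp !subrr normr0 ltxx => -[].
  apply: finite_image_connected.
  apply: (@convex_minus_box_connected _ _ p 0 (r / 2)).
  + exact: near_by_convex.
  + by rewrite lexx divr_gt0.
  all: rewrite /= /near_by /= ?opprD ?opprB ?addNKr ?opprK.
  all: by rewrite !ltr_norml; apply/andP; split; apply/andP; split; lra.
Qed.

(** The complex conjugate of [1 / (z - p)], which sends infinity to zero.  The
    conjugation is harmless: only continuity and injectivity matter. *)
Definition inversion (p : R * R) (x : S) : R * R :=
  if x is Some z then
    let: a := complex.Re z - p.1 in let: b := complex.Im z - p.2 in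
    (a / (a ^+ 2 + b ^+ 2), b / (a ^+ 2 + b ^+ 2))
  else (0, 0).

Lemma sum_sq_gt0 (a b : R) : (a, b) <> (0, 0) -> 0 < a ^+ 2 + b ^+ 2.
Proof.
move=> ab; rewrite lt_def addr_ge0 ?sqr_ge0 // andbT.
rewrite paddr_eq0 ?sqr_ge0 // !sqrf_eq0; apply/negP => /andP[/eqP a0 /eqP b0].
by apply: ab; rewrite a0 b0.
Qed.

Lemma sum_sq_lower_bound (u v s : R) : 0 <= u -> 0 <= v -> s < u \/ s < v ->
  s * u <= u ^+ 2 + v ^+ 2.
Proof.
move=> u0 v0 [su|sv].
  have : 0 <= u * (u - s) by rewrite mulr_ge0 // subr_ge0 ltW.
  by have := sqr_ge0 v; rewrite !expr2 mulrBr; lra.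
have : 0 <= u * (v - s) by rewrite mulr_ge0 // subr_ge0 ltW.
have := sqr_ge0 (u - v); have := sqr_ge0 u; have := sqr_ge0 v.
by rewrite sqrrB !expr2 mulrBr; lra.
Qed.

Lemma inversion_continuous p (x : S) : x <> fin p ->
  {for x, continuous (inversion p)}.
Proof.
have [->|[q ->]] := sphereP x => qp U.
  move=> /near_by_nbhs[e e0 eU]; apply/infinity_nbhs; split.
    by apply: eU; rewrite /= /near_by subrr normr0 e0.
  exists (`|p.1| + `|p.2| + 2 / e).
    by have := divr_gt0 (ltr0Sn R 1) e0; have := normr_ge0 p.1;
      have := normr_ge0 p.2; lra.
  move=> q qe; apply: eU; rewrite /= /near_by /=.
  set a := q.1 - p.1; set b := q.2 - p.2.
  have s0 : 0 < 2 / e by rewrite divr_gt0.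
  set s := 2 / e in s0 qe.
  have se : s * e = 2 by rewrite /s divfK // gt_eqF.
  have ab : s < `|a| \/ s < `|b|.
    have := ler_normD a p.1; have := ler_normD b p.2.
    rewrite /a /b !subrK; have := normr_ge0 p.1; have := normr_ge0 p.2.
    by case: qe => /= h; [left|right]; lra.
  have n0 : 0 < a ^+ 2 + b ^+ 2.
    apply: sum_sq_gt0 => -[a0 b0]; move: ab; rewrite a0 b0 normr0.
    by case; lra.
  have bound (u : R) : (u = a \/ u = b) -> `|u / (a ^+ 2 + b ^+ 2)| < e.
    move=> uab; rewrite normrM normfV (ger0_norm (ltW n0)) ltr_pdivrMr //.
    have su : s * `|u| <= a ^+ 2 + b ^+ 2.
      rewrite -(real_normK (num_real a)) -(real_normK (num_real b)).
      case: uab => ->; first exact: sum_sq_lower_bound.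
      by rewrite addrC; apply: sum_sq_lower_bound => //; case: ab; [right|left].
    have : 2 * `|u| <= e * (a ^+ 2 + b ^+ 2).
      by rewrite -se mulrAC mulrC ler_pM2l.
    have : 0 < e * (a ^+ 2 + b ^+ 2) by exact: mulr_gt0.
    by have := normr_ge0 u; lra.
  by rewrite !sub0r !normrN !bound //; [right|left].
have ab : (q.1 - p.1, q.2 - p.2) <> (0, 0).
  move=> -[a b]; apply: qp; congr fin; move: a b => /eqP + /eqP.
  by rewrite !subr_eq0 => /eqP + /eqP; case: (q) (p) => [? ?] [? ?] /= -> ->.
have n0 : (q.1 - p.1) ^+ 2 + (q.2 - p.2) ^+ 2 != 0.
  by rewrite gt_eqF // sum_sq_gt0.
move=> qU; apply/finite_point_nbhs.
pose F (q : R * R) : R * R := ((q.1 - p.1) / ((q.1 - p.1) ^+ 2 + (q.2 - p.2) ^+ 2),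
  (q.2 - p.2) / ((q.1 - p.1) ^+ 2 + (q.2 - p.2) ^+ 2)).
suff cF : {for q, continuous F} by exact: (cF _ qU).
have c1 : (fun q : R * R => q.1 - p.1) x @[x --> q] --> q.1 - p.1.
  by apply: cvgB; [exact: cvg_fst|exact: cvg_cst].
have c2 : (fun q : R * R => q.2 - p.2) x @[x --> q] --> q.2 - p.2.
  by apply: cvgB; [exact: cvg_snd|exact: cvg_cst].
have cn : (fun q : R * R => (q.1 - p.1) ^+ 2 + (q.2 - p.2) ^+ 2) x @[x --> q] -->
    (q.1 - p.1) ^+ 2 + (q.2 - p.2) ^+ 2.
  by rewrite !expr2; apply: cvgD; apply: cvgM.
exact: (cvg_pair (cvgM c1 (cvgV n0 cn)) (cvgM c2 (cvgV n0 cn))).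
Qed.

Lemma div_sum_sq_inj (a b a' b' : R) : (a, b) <> (0, 0) ->
  a / (a ^+ 2 + b ^+ 2) = a' / (a' ^+ 2 + b' ^+ 2) ->
  b / (a ^+ 2 + b ^+ 2) = b' / (a' ^+ 2 + b' ^+ 2) -> a = a' /\ b = b'.
Proof.
move=> ab ea eb; have n0 := sum_sq_gt0 ab.
have [[a0 b0]|ab'] := pselect ((a', b') = (0, 0)).
  case: ab; move: ea eb; rewrite a0 b0 !mul0r => /eqP + /eqP.
  by rewrite !mulf_eq0 !invr_eq0 (gt_eqF n0) !orbF => /eqP -> /eqP ->.
have n0' := sum_sq_gt0 ab'.
have inv2 (x y : R) : 0 < x ^+ 2 + y ^+ 2 ->
    (x / (x ^+ 2 + y ^+ 2)) ^+ 2 + (y / (x ^+ 2 + y ^+ 2)) ^+ 2 =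
    (x ^+ 2 + y ^+ 2)^-1.
  by move=> /gt_eqF/negbT xy; field.
have nn : a ^+ 2 + b ^+ 2 = a' ^+ 2 + b' ^+ 2.
  by apply: invr_inj; rewrite -(inv2 a b n0) -(inv2 a' b' n0') ea eb.
move: ea eb; rewrite nn; have /gt_eqF/negbT nz := n0'.
by split; apply: (mulIf (invr_neq0 nz)).
Qed.

Lemma inversion_inj p (x y : S) : x <> fin p -> y <> fin p ->
  inversion p x = inversion p y -> x = y.
Proof.
have off q : fin q <> fin p -> (q.1 - p.1, q.2 - p.2) <> (0, 0).
  move=> qp [/eqP + /eqP +]; rewrite !subr_eq0 => /eqP a /eqP b.
  by apply: qp; congr fin; case: (q) (p) a b => [? ?] [? ?] /= -> ->.
have zero q : fin q <> fin p -> (0, 0) <> inversion p (fin q).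
  move=> qp [e1 e2]; apply: (off q qp).
  have [||-> -> //] := @div_sum_sq_inj _ _ 0 0 (off q qp).
    by rewrite -e1 mul0r.
  by rewrite -e2 mul0r.
have [->|[q ->]] := sphereP x; have [->|[q' ->]] := sphereP y => // xp yp.
- by move/(zero _ yp).
- by move/esym/(zero _ xp).
case=> e1 e2; have [] := div_sum_sq_inj (off q xp) e1 e2.
move=> /addIr h1 /addIr h2; congr fin.
by case: (q) (q') h1 h2 => [? ?] [? ?] /= -> ->.
Qed.

(** A basis is formed by the boxes with rational centre and size and the exteriors
    of boxes with integral size. *)
Lemma sphere_second_countable : @second_countable S.
Proof.
pose B (i : (rat * rat * rat) + nat) : set S := match i with
  | inl q => fin @` [set z | near_by (ratr q.2) (ratr q.1.1, ratr q.1.2) z]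
  | inr n => infinity_disk n%:R end.
exists (range B).
  by apply: (sub_countable (card_image_le B setT)); exact: countableP.
have finO (A : set (R * R)) : open A -> open (fin @` A).
  rewrite !openE => oA _ [z Az <-]; apply/finite_point_nbhs.
  by rewrite finite_preimage_image; exact: oA.
split.
  move=> _ [[[[a b] r]|n] _ <-] /=; first exact/finO/near_by_open.
  rewrite openE => x [->|[z ze <-]].
    apply/infinity_nbhs; split; first by left.
    exists (n%:R + 1); first by rewrite ltr_wpDl // ler0n.
    by move=> q qe; right; exists q => //; case: qe => ?; [left|right]; lra.
  have : open (fin @` exterior n%:R).
    apply: finO; rewrite (_ : exterior _ = ~` box (0, 0) n%:R).
      apply: closed_openC; apply: compact_closed; last exact: box_compact_pair.
      exact: norm_hausdorff.
    apply/seteqP; split=> q; rewrite /exterior /box /= !sub0r !normrN.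
      by move=> h [h1 h2]; case: h; rewrite ltNge => /negP.
    move=> h; apply: contrapT => /not_orP[/negP + /negP]; rewrite -!leNgt.
    by move=> h1 h2; apply: h.
  move=> oE; have : nbhs (fin z) (fin @` exterior n%:R).
    by apply: open_nbhs_nbhs; split=> //; exists z.
  by apply: filterS => y; right.
move=> x U; have [->|[p ->]] := sphereP x.
  move=> /infinity_nbhs[UN [r r0 rU]].
  have [n rn] : exists n : nat, r < n%:R.
    by exists (Num.truncn r).+1; rewrite truncnS_gt.
  exists (infinity_disk n%:R); first by split; [exists (inr n)|left].
  move=> y [->//|[q qe <-]]; apply: rU.
  by case: qe => ?; [left|right]; lra.
move=> /finite_point_nbhs /near_by_nbhs[r r0 rU].
have [e] : exists e : rat, (0 : R) < ratr e < r / 2.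
  have [|e] := @rat_in_itvoo R 0 (r / 2); first by rewrite divr_gt0.
  by rewrite in_itv /= => h; exists e.
move=> /andP[e0 er].
have approx (u : R) : exists a : rat, `|ratr a - u| < ratr e.
  have [|a] := @rat_in_itvoo R (u - ratr e) (u + ratr e); first lra.
  by rewrite in_itv /= => h; exists a; rewrite ltr_norml; lra.
have [a ap] := approx p.1; have [b bp] := approx p.2.
exists (B (inl (a, b, e))).
  split; first by exists (inl (a, b, e)).
  by exists p => //=; rewrite /near_by /= ap bp.
move=> _ [q /= /andP[/= qa qb] <-]; apply: rU; rewrite /= /near_by.
move: ap bp qa qb; rewrite !ltr_norml => /andP[? ?] /andP[? ?].
by move=> /andP[? ?] /andP[? ?]; apply/andP; split; apply/andP; split; lra.
Qed.
End Sphere.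

(** * Refinement of atoms *)

Lemma component_open (T : topologicalType) (A : set T) x :
  locally_connected T -> open A -> open (connected_component A x).
Proof.
move=> lT oA; rewrite openE => z xz.
have Az : A z by exact: connected_component_sub xz.
have [V [oV Vz VA cV]] := lT z A (open_nbhs_nbhs (conj oA Az)).
apply: (@filterS _ _ _ V); last exact: open_nbhs_nbhs.
by rewrite (same_connected_component xz); exact: connected_component_max.
Qed.

(** A point of [A] in the boundary would have a connected neighbourhood in [A]
    that meets the component, hence is contained in it. *)
Lemma boundary_component_sub (T : topologicalType) (A : set T) x :
  locally_connected T -> open A -> boundary (connected_component A x) `<=` ~` A.
Proof.
move=> lT oA z [clz niz] Az; apply: niz.
have [V [oV Vz VA cV]] := lT z A (open_nbhs_nbhs (conj oA Az)).
have [y [xy Vy]] := clz V (open_nbhs_nbhs (conj oV Vz)).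
apply: (@filterS _ _ _ V); last exact: open_nbhs_nbhs.
by rewrite (same_connected_component xy); exact: connected_component_max.
Qed.

Section Atoms.
Variable R : realType.
Local Notation S := (riemann_sphere R).
Variables (K U L : set S).
Hypothesis cK : compact K.
Hypothesis oU : open U.
Hypothesis nU : connected U.
Hypothesis UK : U `&` K = set0.
Hypothesis cL : compact L.
Hypothesis LK : L `<=` K.
Hypothesis LU : L `<=` closure U.

Definition inclusion (a : L) : K := exist _ (set_val a) (mem_set (LK (set_valP a))).

Lemma inclusion_continuous : continuous inclusion.
Proof.
move=> a V /set_val_nbhs[W aW WV].
have aW' : nbhs a (set_val @^-1` W) by exact: set_val_continuous.
by apply: (@filterS _ (nbhs a) _ (set_val @^-1` W)) aW' => b Wb; exact: WV.
Qed.

Variable DK : set (set K).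
Hypothesis uDK : usc_decomposition DK.
Hypothesis pDK : peano_compactum R (decomposition_quotient DK).

Local Notation Q := (decomposition_quotient DK).
Local Notation f := (@usc_pi _ DK).
Definition atom_map (a : L) : Q := f (inclusion a).

Lemma atom_map_continuous : continuous atom_map.
Proof.
move=> a; apply: (@continuous_comp _ _ _ inclusion f).
  exact: inclusion_continuous.
exact: usc_pi_continuous.
Qed.

Let hS : hausdorff_space S := @sphere_hausdorff R.
Let hK : hausdorff_space K := set_type_hausdorff hS.
Let ctK : compact [set: K] := set_type_compact cK.
Let hL : hausdorff_space L := set_type_hausdorff hS.
Let ctL : compact [set: L] := set_type_compact cL.

Lemma saturated_connected (C : set Q) : closed C -> connected C ->
  closed (set_val @` (f @^-1` C)) /\ connected (set_val @` (f @^-1` C)).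
Proof.
move=> cC nC.
have cf : closed (f @^-1` C).
  by apply: preimage_closed => // ? _; exact: usc_pi_continuous.
split.
  apply: (compact_closed hS); apply: set_val_image_compact.
  exact: closed_compactT.
apply: set_val_image_connected; apply: monotone_preimage_connected => //.
- exact: usc_pi_closed.
- exact: usc_pi_continuous.
- exact: usc_pi_surj.
- exact: usc_fiber_connected.
Qed.

(** The preimages of [C1] and [C2] in [K] are continua, joined by three disjoint
    continua contained in the boundary of [U].  A point of [U] is removed in order
    to serve as the centre of the inversion. *)
Lemma no_three_connections (C1 C2 : set Q) (N : 'I_3 -> set L) :
  closed C1 -> connected C1 -> closed C2 -> connected C2 -> C1 `&` C2 = set0 ->
  (forall i, closed (N i)) -> (forall i, connected (N i)) ->
  (forall i j, i != j -> N i `&` N j = set0) ->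
  (forall i, exists2 a, N i a & C1 (atom_map a)) ->
  (forall i, exists2 a, N i a & C2 (atom_map a)) -> False.
Proof.
move=> cC1 nC1 cC2 nC2 C12 cN nN dN NC1 NC2.
have [cP nP] := saturated_connected cC1 nC1.
have [cP' nP'] := saturated_connected cC2 nC2.
have inL (A : set L) (x : S) : (set_val @` A) x -> L x.
  by move=> [a _ <-]; exact: set_valP.
have inK (A : set K) (x : S) : (set_val @` A) x -> K x.
  by move=> [a _ <-]; exact: set_valP.
have offK x : U x -> K x -> False.
  by move=> Ux Kx; have : (U `&` K) x by []; rewrite UK.
have [u Uu] : U !=set0.
  have [a _ _] := NC1 0.
  by have [u [Uu _]] := LU (set_valP a) filterT; exists u.
have [p Up] := open_has_finite_point oU (ex_intro _ u Uu).
have cw : closed [set finite_point p].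
  exact/accessible_closed_set1/hausdorff_accessible.
have meet (C : set Q) i : (exists2 a, N i a & C (atom_map a)) ->
    set_val @` (N i) `&` set_val @` (f @^-1` C) !=set0.
  by move=> [a Na Ca]; exists (set_val a); split; [exists a|exists (inclusion a)].
apply: (@three_crossings R S hS (@sphere_compact R) (@sphere_locally_connected R)
  (finite_point p) (inversion p) (@inversion_continuous R p)
  (@inversion_inj R p) (set_val @` (f @^-1` C1)) (set_val @` (f @^-1` C2))
  (U `\ finite_point p) (fun i => set_val @` (N i))) => //.
- rewrite -subset0 => x [[a Ca <-] [b Cb /set_val_inj ba]].
  have : (C1 `&` C2) (f a) by split=> //; rewrite -ba.
  by rewrite C12.
- move=> i; apply: (compact_closed hS); apply: set_val_image_compact.
  exact: closed_compactT.
- by move=> i; exact: set_val_image_connected.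
- move=> i j ij; rewrite -subset0 => x [[a Na <-] [b Nb /set_val_inj ba]].
  have : (N i `&` N j) a by split=> //; rewrite -ba.
  by rewrite dN.
- by move=> i; exact: meet.
- by move=> i; exact: meet.
- by apply: openI => //; exact: closed_openC.
- exact: sphere_punctured_connected.
- move=> i x /inL Lx V xV.
  have xp : nbhs x (V `&` ~` [set finite_point p]).
    apply: filterI => //; apply: open_nbhs_nbhs; split; first exact: closed_openC.
    by move=> xp; apply: (offK x); [rewrite xp|exact: LK].
  by have [y [Uy [Vy yp]]] := LU Lx xp; exists y.
- by rewrite -subset0 => x [[Ux _] /inK]; exact: offK.
- by rewrite -subset0 => x [[Ux _] /inK]; exact: offK.
- by move=> i; rewrite -subset0 => x [[Ux _] /inL /LK]; exact: offK.
- by move=> /inK; exact: offK.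
- by move=> /inK; exact: offK.
- by move=> [_]; apply.
- by move=> i /inL /LK; exact: offK.
Qed.

(** Closures of connected neighbourhoods in [Z], because [no_three_connections]
    is about closed sets. *)
Lemma peano_local_piece (d : Q -> Q -> R) (Z : set Q) x e :
  compatible_metric d -> locally_connected Z -> closed Z -> Z x -> 0 < e ->
  exists C W, [/\ closed C /\ connected C, C `<=` [set y | d x y <= e],
    nbhs x W & W `&` Z `<=` C].
Proof.
move=> cd lZ cZ Zx e0; have [a ax] := set_val_exists Zx.
have aB : nbhs a (set_val @^-1` [set y | d x y < e]).
  by apply: set_val_continuous; rewrite ax; exact: compatible_ball_nbhs.
have [V [oV Va VB cV]] := lZ a _ aB.
have [W xW WV] := set_val_nbhs (open_nbhs_nbhs (conj oV Va)).
rewrite ax in xW.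
exists (closure (set_val @` V)), W; split=> //.
- split; first exact: closed_closure.
  exact/connected_closure/set_val_image_connected.
- have cB := @compatible_cball_closed _ _ d cd x e.
  rewrite (iffLR (closure_id _) cB).
  by apply: closureS => _ [b /VB /ltW ? <-].
- move=> y [Wy Zy]; have [b bY] := set_val_exists Zy.
  by apply: subset_closure; exists b => //; apply: WV; rewrite /= bY.
Qed.

(** If [g x] and [g y] differ, then almost all sets [g @` N i] are large, so they
    lie in finitely many components of [Q], and eventually in the component [Z]
    of [g x], which also contains [g y].  Local connectedness of [Z] provides
    small disjoint continua around [g x] and [g y] that almost all of these sets
    meet. *)
Lemma parallel_continua (F : set_system nat) (N : nat -> set L)
    (a b : nat -> L) x y : UltraFilter F -> \oo `<=` F ->
  (forall i, closed (N i)) -> (forall i, connected (N i)) ->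
  (forall i j, i != j -> N i `&` N j = set0) ->
  (forall i, N i (a i)) -> (forall i, N i (b i)) ->
  a @ F --> x -> b @ F --> y -> atom_map x = atom_map y.
Proof.
move=> UF ooF cN nN dN Na Nb ax bY; apply: contrapT => xy.
have [_ lcQ [d cd fin]] := pDK; have [d0 dd sy tr nb] := cd.
set g := atom_map in xy.
have dge0 p q : 0 <= d p q.
  by have := tr q p p; rewrite d0 (sy q p); lra.
have dxy : 0 < d (g x) (g y).
  by rewrite lt_def dge0 andbT; apply/eqP => /dd.
(* The fraction must be below 1/2 for C1 and C2 to be disjoint, and below 1/3
   for the images of the N i to have diameter larger than e. *)
pose e := d (g x) (g y) / 4.
have e0 : 0 < e by rewrite divr_gt0.
have lim (c : nat -> L) z V : c @ F --> z -> nbhs (g z) V ->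
    F [set i | V (g (c i))].
  by move=> cz zV; exact: (cz _ (atom_map_continuous zV)).
pose Z := connected_component [set: Q] (g x).
have Zx : Z (g x) by exact: connected_component_refl.
have cZ : closed Z by exact: component_closed.
have lZ : locally_connected Z by apply: lcQ; exists (g x).
pose G := [set A | (components [set: Q] A /\ (e%:E < diameter d A)%E) /\ ~ A (g x)].
have cG : closed (\bigcup_(A in G) A).
  apply: closed_bigcup; first by apply: sub_finite_set (fin e e0) => A [].
  by move=> A [[[z _ <-] _] _]; exact: component_closed.
(* The large components other than Z stay away from g x. *)
have nearZ : F [set i | Z (g (a i)) /\ Z (g (b i))].
  have Fa : F [set i | d (g x) (g (a i)) < e].
    exact: lim ax (compatible_ball_nbhs cd _ e0).
  have Fb : F [set i | d (g y) (g (b i)) < e].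
    exact: lim bY (compatible_ball_nbhs cd _ e0).
  have FG : F [set i | (~` \bigcup_(A in G) A) (g (a i))].
    apply: lim ax _; apply: open_nbhs_nbhs; split; first exact: closed_openC.
    by move=> [A [_ nA] /nA].
  apply: (filterS _ (filterI FG (filterI Fa Fb))) => i [nGa [/= da db]].
  pose A := connected_component [set: Q] (g (a i)).
  have gN : g @` N i `<=` A.
    apply: connected_component_max => //; first by exists (a i).
    apply: connected_continuous_connected => //.
    by apply: continuous_subspaceT; exact: atom_map_continuous.
  have Aa : A (g (a i)) by exact: connected_component_refl.
  have Ab : A (g (b i)) by apply: gN; exists (b i).
  have Ax : A (g x).
    apply: contrapT => nAx; apply: nGa; exists A => //; split=> //; split.
      by exists (g (a i)).
    apply: (@lt_le_trans _ _ (d (g (a i)) (g (b i)))%:E).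
      rewrite lte_fin; have := tr (g (a i)) (g x) (g y).
      have := tr (g (b i)) (g (a i)) (g y); rewrite (sy (g (b i)) (g y)).
      have : d (g x) (g y) = 4 * e by rewrite /e mulrC divfK.
      by lra.
    by apply: ereal_sup_ubound; exists (g (a i), g (b i)).
  have ZA : Z = A by exact/esym/same_connected_component.
  by rewrite /= ZA.
have Zy : Z (g y).
  apply: contrapT => nZy.
  have Fb : F [set i | (~` Z) (g (b i))].
    by apply: lim bY _; apply: open_nbhs_nbhs; split=> //; exact: closed_openC.
  by have [i [[_ Zb] nZb]] := @filter_ex _ F _ _ (filterI nearZ Fb).
have [C1 [W1 [[cC1 nC1] C1e W1x WC1]]] := peano_local_piece cd lZ cZ Zx e0.
have [C2 [W2 [[cC2 nC2] C2e W2y WC2]]] := peano_local_piece cd lZ cZ Zy e0.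
have FA : F [set i | C1 (g (a i)) /\ C2 (g (b i))].
  apply: (filterS _ (filterI nearZ (filterI (lim _ _ _ ax W1x) (lim _ _ _ bY W2y)))).
  by move=> i [[Za Zb] [Wa Wb]]; split; [exact: WC1|exact: WC2].
have next k : exists i, (k < i)%N /\ (C1 (g (a i)) /\ C2 (g (b i))).
  have Fk : F [set i | (k < i)%N] by apply: ooF; exact: nbhs_infty_gt.
  by have [i [? ?]] := @filter_ex _ F _ _ (filterI Fk FA); exists i.
have [nx nxP] := choice next.
(* Three increasing indices, to get three distinct continua. *)
pose idx (i : 'I_3) := iter i.+1 nx 0%N.
have idx_inj i j : i != j -> idx i != idx j.
  have mono k l : (k < l)%N -> (iter k.+1 nx 0 < iter l.+1 nx 0)%N.
    elim: l => // l IH; rewrite ltnS leq_eqVlt => /orP[/eqP ->|/IH kl].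
      by have [] := nxP (iter l.+1 nx 0%N).
    by apply: ltn_trans kl _; have [] := nxP (iter l.+1 nx 0%N).
  move=> ij; have : (val i != val j) by [].
  by rewrite neq_ltn => /orP[] /mono; rewrite neq_ltn => ->; rewrite ?orbT.
apply: (@no_three_connections C1 C2 (N \o idx)) => //.
- rewrite -subset0 => z [/C1e /= zx /C2e /= zy].
  have := tr z (g x) (g y); rewrite (sy z (g y)).
  have : d (g x) (g y) = 4 * e by rewrite /e mulrC divfK.
  by move: dxy; lra.
- by move=> i; exact: cN.
- by move=> i; exact: nN.
- by move=> i j ij; apply: dN; exact: idx_inj.
- by move=> i; exists (a (idx i)) => //=; case: (nxP (iter i nx 0%N)) => _ [].
- by move=> i; exists (b (idx i)) => //=; case: (nxP (iter i nx 0%N)) => _ [].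
Qed.

(** The components of the fibres of [atom_map] are an admissible decomposition of
    [L], which the core decomposition [DL] refines by minimality. *)
Theorem atoms_refine (DL : set (set L)) : core_decomposition R DL ->
  forall a, DL a -> exists2 b, DK b & set_val @` a `<=` set_val @` b.
Proof.
move=> [_ _ minDL] a DLa.
have hQ : hausdorff_space Q by exact: usc_quotient_hausdorff.
have cg := atom_map_continuous.
have uF := fiber_components_usc hL ctL hQ cg.
have pF : peano_compactum R (decomposition_quotient (fiber_components atom_map)).
  apply: (fiber_components_peano hL ctL hQ cg).
    exact: parallel_continua.
  exact/set_type_second_countable/sphere_second_countable.
have [_ [x _ <-] ax] := minDL _ uF pF a DLa.
have [b [DKb bx _]] := iffLR (same_elementE uDK (inclusion x) (inclusion x))
  (same_element_refl DK (inclusion x)).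
exists b => // _ [y ay <-]; exists (inclusion y) => //.
have /fiber_componentE /usc_piE /asboolP yx := ax y ay.
exact/(yx b DKb).
Qed.
End Atoms.

Theorem theorem1 (R : realType) (K U L : set (riemann_sphere R))
    (K_compact : compact K)
    (U_component : components (~` K) U)
    (L_compact : compact L)
    (L_boundary : L `<=` boundary U)
    (DL : set (set L)) (DL_core : core_decomposition R DL) :
  (forall DK : set (set K), core_decomposition R DK ->
     forall a, DL a -> exists2 b, DK b & set_val @` a `<=` set_val @` b) /\
  (forall DB : set (set (boundary U)), core_decomposition R DB ->
     forall a, DL a -> exists2 b, DB b & set_val @` a `<=` set_val @` b).
Proof.
have cK : closed K.
  by apply: compact_closed => //; exact: sphere_hausdorff.
have lS := @sphere_locally_connected R.
case: U_component => x Kx UE.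
have oU : open U by rewrite -UE; apply: component_open => //; exact: closed_openC.
have nU : connected U by rewrite -UE; exact: component_connected.
have UK : U `&` K = set0.
  by rewrite -UE -subset0 => z [/connected_component_sub].
have bU : boundary U `<=` K.
  have := @boundary_component_sub _ (~` K) x lS (closed_openC cK).
  by rewrite UE setCK.
have LU : L `<=` closure U by move=> z /L_boundary[].
split=> [DK [uDK pDK _]|DB [uDB pDB _]].
  apply: (atoms_refine K_compact oU nU UK L_compact _ LU uDK pDK DL_core).
  by move=> z /L_boundary /bU.
have bUE : boundary U = closure U `&` ~` U.
  by rewrite /boundary (interior_id _).1.
have cB : compact (boundary U).
  apply: (subclosed_compact _ (@sphere_compact R)) => //.
  by rewrite bUE; apply: closedI; [exact: closed_closure|exact: open_closedC].
apply: (atoms_refine cB oU nU _ L_compact L_boundary LU uDB pDB DL_core).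
by rewrite bUE -subset0 => z [Uz [_ nUz]].
Qed.
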